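(* (a) Let $(a_1,a_2)$ and $(b_1,b_2)$ be two points in the bidisk $\mathbb{D}^2$. Then there is a distinguished variety $V\cap\mathbb{D}^2$ such that the Schwarz-Pick inequality $$\left| \frac{f(a_1,a_2) - f(b_1,b_2)}{1 - \overline{f(a_1,a_2)} f(b_1,b_2)} \right| \leq \max\left\{ \left| \frac{a_1 - b_1}{1 - \overline{a_1}b_1}\right|, \left| \frac{a_2 - b_2}{1 - \overline{a_2}b_2} \right|\right\}\qquad( * )$$ holds for any function $f$ which is holomorphic on the bidisk $\mathbb{D}^2$ and continuous on $\overline{\mathbb{D}}^2$ with $$\sup_{(z_1,z_2)\in V \cap \mathbb{D}^2} |f(z_1,z_2)| \le 1.$$ (b) Let $(a_1,a_2)$ and $(b_1,b_2)$ be two points in the bidisk $\mathbb{D}^2$. Then there is a distinguished variety $V\cap\mathbb{D}^2$ such that the inequality $( * )$ holds for any function $f$ which is holomorphic in the bidisk $\mathbb{D}^2$ and for which there is a sequence of positive real numbers $(r_n)_{n\ge 1}$ convergent to $1$ with $r_n < 1$ such that $$\sup_{n\ge 1,\ (z_1,z_2)\in V \cap \mathbb{D}^2} |f(r_nz_1,r_nz_2)| \le 1.$$ In both parts, the left-hand side of $( * )$ is read as $0$ when numerator and denominator both vanish.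
   Context: $\mathbb{D}$ is the open unit disk in $\mathbb{C}$, $\overline{\mathbb{D}}$ its closure, $\mathbb{T}=\overline{\mathbb{D}}\setminus\mathbb{D}$ the unit circle, and $\partial(\mathbb{D}^2)$ the topological boundary of $\mathbb{D}^2$ in $\mathbb{C}^2$. A distinguished variety is the trace $V\cap\mathbb{D}^2=\{(z,w)\in\mathbb{D}^2: q(z,w)=0\}$ on the bidisk of a one-dimensional algebraic set $V=\{q=0\}\subset\mathbb{C}^2$ ($q\in\mathbb{C}[z,w]$), such that $V$ meets $\mathbb{D}^2$ and exits the bidisk only through its distinguished boundary $\mathbb{T}^2$: writing $\overline{V\cap\mathbb{D}^2}$ for the closure, $\overline{V\cap\mathbb{D}^2}\cap\partial(\mathbb{D}^2)=\overline{V\cap\mathbb{D}^2}\cap\mathbb{T}^2$. *)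

(* Defs.v *)
From HB Require Import structures.
From mathcomp Require Import all_boot all_order all_algebra.
From mathcomp Require Import complex.
From mathcomp Require Import all_classical all_reals all_analysis.

Set Implicit Arguments.
Unset Strict Implicit.
Unset Printing Implicit Defensive.

Import Order.TTheory GRing.Theory Num.Theory.
Import numFieldNormedType.Exports.

Local Open Scope classical_set_scope.
Local Open Scope ring_scope.

(* Giving [R[i]] the type [numClosedFieldType] makes MathComp-Analysis equip it,
   and its square, with the topology and [normedModType] structure over itself;
   [differentiable] below is therefore complex (Frechet) differentiability. *)
Definition Cx (R : realType) : numClosedFieldType := R[i].

Notation C2 R := (Cx R * Cx R)%type.

Definition disk (R : realType) : set (Cx R) := [set z | `|z| < 1].

Definition circle (R : realType) : set (Cx R) := closure (@disk R) `\` @disk R.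

Definition bidisk (R : realType) : set (C2 R) := @disk R `*` @disk R.

Definition closed_bidisk (R : realType) : set (C2 R) :=
  closure (@disk R) `*` closure (@disk R).

Definition torus (R : realType) : set (C2 R) := @circle R `*` @circle R.

Definition boundary (T : topologicalType) (A : set T) : set T :=
  closure A `\` interior A.

(* [q] is a polynomial in [w] whose coefficients are polynomials in [z]. *)
Definition zero_set (R : realType) (q : {poly {poly Cx R}}) : set (C2 R) :=
  [set p | q.[(p.2)%:P].[p.1] = 0].

(* The zero set of [q] is an algebraic set of dimension one in C^2 exactly when
   [q] is not a constant (including the constant 0). *)
Definition distinguished_variety (R : realType) (W : set (C2 R)) : Prop :=
  exists q : {poly {poly Cx R}},
    [/\ forall c : Cx R, q <> c%:P%:P,
        W = zero_set q `&` @bidisk R,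
        W !=set0 &
        closure W `&` boundary (@bidisk R) = closure W `&` @torus R].

Definition holomorphic_on (R : realType) (U : set (C2 R)) (f : C2 R -> Cx R) :
    Prop :=
  forall p : C2 R, U p -> differentiable f p.

Definition pseudo_hyperbolic (R : realType) (u v : Cx R) : Cx R :=
  `|(u - v) / (1 - u^* * v)|.

(* Division by 0 yields 0 here. This is the right reading of 0/0, but a zero
   denominator under a nonzero numerator has to be excluded explicitly.
   [Num.max] is applied to moduli, which are real and hence comparable. *)
Definition schwarz_pick (R : realType) (f : C2 R -> Cx R) (a b : C2 R) : Prop :=
  (1 - (f a)^* * f b = 0 -> f a - f b = 0) /\
  pseudo_hyperbolic (f a) (f b) <=
    Num.max (pseudo_hyperbolic a.1 b.1) (pseudo_hyperbolic a.2 b.2).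

Definition dilate (R : realType) (r : R) (p : C2 R) : C2 R :=
  ((r%:C)%C * p.1, (r%:C)%C * p.2).

(* Main.v *)
Require Import Defs.
From HB Require Import structures.
From mathcomp Require Import all_boot all_order all_algebra.
From mathcomp Require Import complex.
From mathcomp Require Import all_classical all_reals all_analysis.
From mathcomp Require Import ring lra.
Import Order.TTheory GRing.Theory Num.Theory.
Import numFieldNormedType.Exports.
Local Open Scope classical_set_scope.
Local Open Scope ring_scope.

(** Exchanging the coordinates if necessary, let [d] be the pseudo-hyperbolic
    distance of the first coordinates [a.1] and [b.1] and suppose that it is at
    least that of the second ones.  Then some Blaschke product [phi] of degree
    one or two satisfies [phi a.1 = a.2] and [phi b.1 = b.2], and its graph
    [w = phi z] is the distinguished variety: writing [phi = P / Q], the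
    equation [Q z * w = P z] forces [|w| = 1] exactly when [|z| = 1], because
    [|P| < |Q|] inside the disk and [|P| = |Q|] on the circle.  The whole graph
    over the disk lies in the variety, so a function [f] bounded by 1 on the
    variety restricts to a holomorphic self-map [g z = f (z, phi z)] of the
    closed disk, and the one-variable Schwarz-Pick inequality for [g] at [a.1]
    and [b.1] is the claim.  The same variety serves part (b): for a point [p]
    of the variety, [f (r_n p)] tends to [f p], so [|f| <= 1] on the variety
    again ([modulus_le1_of_dilates]).

    The one-variable inequality is proved from complex differentiability alone.
    Goursat's subdivision argument ([goursat]) is applied to [f (exp zeta)] on
    rectangles of height [2 * pi]; the horizontal sides cancel by periodicity,
    so the mean of [f] over the circle of radius [r] does not depend on [r], and
    letting a second radius shrink to 0 bounds [|f 0|] by twice the maximum of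
    [|f|] on any circle ([modulus_center_le]).  The factor 2 is harmless: if [k]
    is bounded by 1 and vanishes at [s], the estimate is applied to
    [k * (k / m) ^ n], where [m] is the Moebius map vanishing at [s], and the
    factor disappears as [n] grows, which gives Schwarz's lemma
    ([schwarz_center]).  Composing with Moebius maps on both sides yields
    Schwarz-Pick ([schwarz_pick_disk]). *)

(** * The modulus as a real number *)

(** The norm of [Cx R] takes values in [Cx R], which is only partially ordered;
    its real part lives in the ordered field [R]. *)
Definition modulus {R : realType} (z : Cx R) : R := complex.Re `|z|.

Section Modulus.
Context {R : realType}.
Implicit Types z w : Cx R.

Lemma modulusE z : `|z| = ((modulus z)%:C)%C.
Proof. by rewrite /modulus; case: z => x y. Qed.

Lemma normr_le1 z : (`|z| <= 1) = (modulus z <= 1).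
Proof. by rewrite modulusE -[1 in LHS]/((1 : R)%:C)%C lecR. Qed.

Lemma normr_lt1 z : (`|z| < 1) = (modulus z < 1).
Proof. by rewrite modulusE -[1 in LHS]/((1 : R)%:C)%C ltcR. Qed.

Lemma real_complex_gt0 (e : R) : 0 < e -> 0 < ((e%:C)%C : Cx R).
Proof. by move=> e0; rewrite -[0]/((0 : R)%:C)%C ltcR. Qed.

Lemma modulus0 : modulus (0 : Cx R) = 0.
Proof. by rewrite /modulus normr0. Qed.

Lemma modulus1 : modulus (1 : Cx R) = 1.
Proof. by rewrite /modulus normr1. Qed.

Lemma modulusM z w : modulus (z * w) = modulus z * modulus w.
Proof.
by apply: complexI; rewrite rmorphM /= -!modulusE normrM.
Qed.

Lemma modulusN z : modulus (- z) = modulus z.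
Proof. by rewrite /modulus normrN. Qed.

Lemma modulusB z w : modulus (z - w) = modulus (w - z).
Proof. by rewrite /modulus distrC. Qed.

Lemma modulusV z : modulus z^-1 = (modulus z)^-1.
Proof. by apply: complexI; rewrite fmorphV /= -!modulusE normfV. Qed.

Lemma modulus_div z w : modulus (z / w) = modulus z / modulus w.
Proof. by rewrite modulusM modulusV. Qed.

Lemma modulusX z n : modulus (z ^+ n) = modulus z ^+ n.
Proof. by apply: complexI; rewrite rmorphXn /= -!modulusE normrX. Qed.

Lemma modulusJ z : modulus z^* = modulus z.
Proof. by rewrite /modulus norm_conjC. Qed.

Lemma modulusD z w : modulus (z + w) <= modulus z + modulus w.
Proof. by rewrite -lecR rmorphD /= -!modulusE ler_normD. Qed.

Lemma modulus_real (x : R) : modulus (x%:C)%C = `|x|.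
Proof.
by rewrite /modulus normc_def /= expr0n addr0 sqrtr_sqr.
Qed.

Lemma modulus_ge0 z : 0 <= modulus z.
Proof.
have := normr_ge0 z.
by rewrite modulusE -[0 in X in X -> _]/((0 : R)%:C)%C lecR.
Qed.

Lemma modulus_eq0 z : (modulus z == 0) = (z == 0).
Proof.
apply/eqP/eqP => [z0|->]; last exact: modulus0.
by apply/eqP; rewrite -normr_eq0 modulusE z0.
Qed.

Lemma modulus_gt0 z : (0 < modulus z) = (z != 0).
Proof. by rewrite lt_neqAle modulus_ge0 andbT eq_sym modulus_eq0. Qed.

Lemma modulus_sqr z :
  modulus z ^+ 2 = complex.Re z ^+ 2 + complex.Im z ^+ 2.
Proof.
by apply: complexI; rewrite rmorphXn /= -modulusE add_Re2_Im2.
Qed.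

Lemma modulus_sqrJ z : ((modulus z ^+ 2)%:C)%C = z * z^*.
Proof. by rewrite rmorphXn /= -modulusE normCK. Qed.

Lemma Re_le_modulus z : `|complex.Re z| <= modulus z.
Proof.
rewrite -ler_sqr ?nnegrE ?modulus_ge0 // modulus_sqr real_normK ?num_real //.
by rewrite lerDl sqr_ge0.
Qed.

Lemma Im_le_modulus z : `|complex.Im z| <= modulus z.
Proof.
rewrite -ler_sqr ?nnegrE ?modulus_ge0 // modulus_sqr real_normK ?num_real //.
by rewrite lerDr sqr_ge0.
Qed.

Lemma modulus_le_ReIm z :
  modulus z <= `|complex.Re z| + `|complex.Im z|.
Proof.
rewrite -ler_sqr ?nnegrE ?modulus_ge0 ?addr_ge0 // modulus_sqr.
rewrite -[complex.Re z ^+ 2]real_normK ?num_real //.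
rewrite -[complex.Im z ^+ 2]real_normK ?num_real //.
have := normr_ge0 (complex.Re z); have := normr_ge0 (complex.Im z); nra.
Qed.

Lemma modulus_i : modulus ('i : Cx R) = 1.
Proof. by rewrite /modulus normCi. Qed.

Lemma modulus_le_dist z w : modulus z <= modulus w + modulus (z - w).
Proof. by have := modulusD w (z - w); rewrite addrC subrK. Qed.

End Modulus.

(** * Integrals of complex functions on a segment *)

Section RealIntegral.
Context {R : realType}.
Local Notation mu := (@lebesgue_measure R).

Lemma integrable_segment (a b : R) (f : R -> R) :
  (forall x, a <= x <= b -> {for x, continuous f}) ->
  mu.-integrable `[a, b] (EFin \o f).
Proof.
move=> cf; apply: continuous_compact_integrable; first exact: segment_compact.
by apply: continuous_in_subspaceT => x /[!inE] /= /[!in_itv] /=; exact: cf.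
Qed.

(** The single quantitative fact about integrals that is needed: both the
    evaluation of integrals of constants and every integral bound below are
    instances of it. *)
Lemma Rintegral_near_cst (a b k d : R) (f : R -> R) : a <= b ->
  (forall x, a <= x <= b -> {for x, continuous f}) ->
  (forall x, a <= x <= b -> `|f x - k| <= d) ->
  `| \int[mu]_(x in `[a, b]) f x - (b - a) * k | <= (b - a) * d.
Proof.
move=> ab cf fk.
have If := integrable_segment _ _ _ cf.
have cst c : \int[mu]_(x in `[a, b]) c = (b - a) * c.
  rewrite Rintegral_cst //= lebesgue_measure_itv /= lte_fin.
  case: ltgtP ab => //= [ab _|-> _]; last by rewrite mulr0 subrr mul0r.
  by rewrite mulrC.
have Ic c : mu.-integrable `[a, b] (EFin \o (fun _ : R => c)).
  by apply: integrable_segment => x _; exact: cvg_cst.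
have leI (g h : R -> R) : mu.-integrable `[a, b] (EFin \o g) ->
    mu.-integrable `[a, b] (EFin \o h) ->
    (forall x, a <= x <= b -> g x <= h x) ->
    \int[mu]_(x in `[a, b]) g x <= \int[mu]_(x in `[a, b]) h x.
  by move=> Ig Ih gh; apply: le_Rintegral => // x /=; rewrite in_itv /=; exact: gh.
have lo : \int[mu]_(x in `[a, b]) (k - d) <= \int[mu]_(x in `[a, b]) f x.
  by apply: leI => // x /fk; rewrite ler_norml; lra.
have hi : \int[mu]_(x in `[a, b]) f x <= \int[mu]_(x in `[a, b]) (k + d).
  by apply: leI => // x /fk; rewrite ler_norml; lra.
move: lo hi; rewrite !cst ler_norml; clear.
move: (Rintegral _ _ _) => I lo hi; lra.
Qed.

Lemma Rintegral_split (a m b : R) (f : R -> R) : a <= m -> m <= b ->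
  (forall x, a <= x <= b -> {for x, continuous f}) ->
  \int[mu]_(x in `[a, b]) f x =
  \int[mu]_(x in `[a, m]) f x + \int[mu]_(x in `[m, b]) f x.
Proof.
move=> am mb cf.
have If := integrable_segment _ _ _ cf.
have := @Rintegral_itvB _ f (BLeft a) (BRight b) m If.
rewrite !bnd_simp => /(_ am mb); rewrite Rintegral_itv_obnd_cbnd; last first.
  apply: integrableS If => //; apply: subset_itvr.
  by rewrite bnd_simp.
by move=> <-; rewrite addrC subrK.
Qed.

End RealIntegral.

(** Continuity at the points of the segment as a function on the whole line,
    in epsilon-delta form so that it can be stated with real moduli. *)
Definition segment_continuous {R : realType} (a b : R) (phi : R -> Cx R) : Prop :=
  forall x, a <= x <= b -> forall e : R, 0 < e ->
    exists2 d : R, 0 < d &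
      forall y, `|y - x| < d -> modulus (phi y - phi x) < e.

Definition path_integral {R : realType} (a b : R) (phi : R -> Cx R) : Cx R :=
  let mu := @lebesgue_measure R in
  (\int[mu]_(x in `[a, b]) complex.Re (phi x) +i*
   \int[mu]_(x in `[a, b]) complex.Im (phi x))%C.

Section ComplexIntegral.
Context {R : realType}.
Implicit Types (a b : R) (phi psi : R -> Cx R).
Local Notation mu := (@lebesgue_measure R).

Lemma segment_continuous_Re a b phi : segment_continuous a b phi ->
  forall x, a <= x <= b -> {for x, continuous (fun y => complex.Re (phi y))}.
Proof.
move=> cf x xab; apply/cvgrPdist_lt => e e0.
have [d d0 H] := cf x xab e e0.
near=> y; apply: le_lt_trans (H y _); last first.
  by rewrite distrC; near: y; apply: cvgr_dist_lt => //; exact: cvg_id.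
by rewrite distrC -raddfB; exact: Re_le_modulus.
Unshelve. all: by end_near. Qed.

Lemma segment_continuous_Im a b phi : segment_continuous a b phi ->
  forall x, a <= x <= b -> {for x, continuous (fun y => complex.Im (phi y))}.
Proof.
move=> cf x xab; apply/cvgrPdist_lt => e e0.
have [d d0 H] := cf x xab e e0.
near=> y; apply: le_lt_trans (H y _); last first.
  by rewrite distrC; near: y; apply: cvgr_dist_lt => //; exact: cvg_id.
by rewrite distrC -raddfB; exact: Im_le_modulus.
Unshelve. all: by end_near. Qed.

Lemma segment_continuousD a b phi psi :
  segment_continuous a b phi -> segment_continuous a b psi ->
  segment_continuous a b (fun x => phi x + psi x).
Proof.
move=> cf cg x xab e e0.
have e20 : 0 < e / 2 by rewrite divr_gt0.
have [d1 d10 H1] := cf x xab _ e20; have [d2 d20 H2] := cg x xab _ e20.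
exists (Num.min d1 d2); first by rewrite lt_min d10.
move=> y; rewrite lt_min => /andP[/H1 h1 /H2 h2].
rewrite opprD addrACA; apply: le_lt_trans (modulusD _ _) _.
by rewrite [e]splitr ltrD.
Qed.

Lemma segment_continuousN a b phi :
  segment_continuous a b phi -> segment_continuous a b (fun x => - phi x).
Proof.
move=> cf x xab e /(cf x xab)[d d0 H]; exists d => // y /H.
by rewrite -opprD modulusN.
Qed.

Lemma segment_continuousB a b (phi psi : R -> Cx R) :
  segment_continuous a b phi -> segment_continuous a b psi ->
  segment_continuous a b (fun x => phi x - psi x).
Proof.
by move=> cf cg; apply: segment_continuousD => //; exact: segment_continuousN.
Qed.

Lemma path_integralD a b phi psi :
  segment_continuous a b phi -> segment_continuous a b psi ->
  path_integral a b (fun x => phi x + psi x) =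
  path_integral a b phi + path_integral a b psi.
Proof.
move=> cf cg; apply/eqP; rewrite eq_complex /= -!RintegralD //=.
- by apply/andP; split; apply/eqP; apply: eq_Rintegral => x _; rewrite raddfD.
- by apply: integrable_segment; exact: segment_continuous_Im.
- by apply: integrable_segment; exact: segment_continuous_Im.
- by apply: integrable_segment; exact: segment_continuous_Re.
- by apply: integrable_segment; exact: segment_continuous_Re.
Qed.

Lemma path_integral_split a m b phi : a <= m -> m <= b ->
  segment_continuous a b phi ->
  path_integral a b phi = path_integral a m phi + path_integral m b phi.
Proof.
move=> am mb cf; apply/eqP; rewrite eq_complex /=.
rewrite -!Rintegral_split ?eqxx //.
- exact: segment_continuous_Im.
- exact: segment_continuous_Re.
Qed.

(** Estimating the real and the imaginary parts separately costs a factor 2,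
    which no later argument minds. *)
Lemma path_integral_near_cst a b (k : Cx R) (d : R) phi : a <= b ->
  segment_continuous a b phi ->
  (forall x, a <= x <= b -> modulus (phi x - k) <= d) ->
  modulus (path_integral a b phi - ((b - a)%:C)%C * k) <= 2 * ((b - a) * d).
Proof.
move=> ab cf near.
have hr := Rintegral_near_cst a b (complex.Re k) d _ ab
  (segment_continuous_Re _ _ _ cf).
have hi := Rintegral_near_cst a b (complex.Im k) d _ ab
  (segment_continuous_Im _ _ _ cf).
apply: le_trans (modulus_le_ReIm _) _; rewrite mulr_natl mulr2n lerD //.
- have -> : complex.Re (path_integral a b phi - ((b - a)%:C)%C * k) =
    \int[mu]_(x in `[a, b]) complex.Re (phi x) - (b - a) * complex.Re k.
    by case: k {near hr hi} => kr ki /=; rewrite mul0r subr0.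
  apply: hr => x /near; apply: le_trans.
  by rewrite -raddfB; exact: Re_le_modulus.
- have -> : complex.Im (path_integral a b phi - ((b - a)%:C)%C * k) =
    \int[mu]_(x in `[a, b]) complex.Im (phi x) - (b - a) * complex.Im k.
    by case: k {near hr hi} => kr ki /=; rewrite mul0r addr0.
  apply: hi => x /near; apply: le_trans.
  by rewrite -raddfB; exact: Im_le_modulus.
Qed.

End ComplexIntegral.

(** * Goursat's theorem on rectangles *)

(** Complex differentiability of [G x y] as a function of [x + i y]. *)
Definition complex_differentiable {R : realType} (G : R -> R -> Cx R) (x y : R)
    : Prop :=
  exists c : Cx R, forall e : R, 0 < e -> exists2 d : R, 0 < d &
    forall x' y', `|x' - x| < d -> `|y' - y| < d ->
      modulus (G x' y' - G x y - c * ((x' - x) +i* (y' - y))%C) <=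
        e * (`|x' - x| + `|y' - y|).

(** The integral of [G] along the boundary of the rectangle with opposite corners
    [a + i c] and [b + i d].  Opposite sides are grouped so that the integrands
    become constant when [G] is affine. *)
Definition rectangle_integral {R : realType} (G : R -> R -> Cx R)
    (a b c d : R) : Cx R :=
  path_integral a b (fun x => G x c - G x d) +
  'i * path_integral c d (fun y => G b y - G a y).

Section NestedRectangles.
Context {R : realType}.

(** The left ends increase and the right ends decrease, so the supremum of the
    left ends lies in all the intervals. *)
Lemma nested_intervals (w : R) (u : nat -> R) : 0 <= w ->
  (forall n, u n <= u n.+1) ->
  (forall n, u n.+1 + w / 2 ^+ n.+1 <= u n + w / 2 ^+ n) ->
  exists x, forall n, u n <= x <= u n + w / 2 ^+ n.
Proof.
move=> w0 ui vd.
have um m k : u m <= u (m + k)%N.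
  by elim: k => [|k IH]; rewrite ?addn0 // addnS (le_trans IH).
have vm m k : u (m + k)%N + w / 2 ^+ (m + k) <= u m + w / 2 ^+ m.
  by elim: k => [|k IH]; rewrite ?addn0 // addnS (le_trans _ IH).
have uv m n : u m <= u n + w / 2 ^+ n.
  have wn k : 0 <= w / 2 ^+ k by rewrite divr_ge0 // exprn_ge0.
  have [mn|/ltnW nm] := leqP m n.
    by have := um m (n - m)%N; have := wn n; rewrite subnKC //; lra.
  by have := vm n (m - n)%N; have := wn m; rewrite subnKC //; lra.
exists (sup (range u)) => n; apply/andP; split.
  apply: ub_le_sup; last by exists n.
  by exists (u n + w / 2 ^+ n) => _ [m _ <-]; exact: uv.
by apply: ge_sup => [|_ [m _ <-]]; [exists (u n); exists n|exact: uv].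
Qed.

(** The bisection scheme: a property passed on from each rectangle to one of
    its four quarters holds for rectangles shrinking to a point. *)
Lemma nested_rectangles (w h : R) (P : nat -> R -> R -> Prop) (a0 c0 : R) :
  0 <= w -> 0 <= h -> P 0%N a0 c0 ->
  (forall n a c, P n a c -> exists i j : bool,
     P n.+1 (a + i%:R * (w / 2 ^+ n.+1)) (c + j%:R * (h / 2 ^+ n.+1))) ->
  exists x y, forall n, exists a c,
    [/\ P n a c, a <= x <= a + w / 2 ^+ n & c <= y <= c + h / 2 ^+ n].
Proof.
move=> w0 h0 P0 step.
have half (z : R) n : z / 2 ^+ n = z / 2 ^+ n.+1 + z / 2 ^+ n.+1.
  by rewrite exprS invfM mulrA mulrAC -splitr.
pose Q n (p : R * R) := P n p.1 p.2.
have next n (p : R * R) : exists q : R * R, Q n p -> Q n.+1 q /\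
    exists i j : bool, q = (p.1 + i%:R * (w / 2 ^+ n.+1),
                            p.2 + j%:R * (h / 2 ^+ n.+1)).
  have [Qp|nQ] := pselect (Q n p); last by exists p.
  have [i [j Pij]] := step _ _ _ Qp.
  by exists (p.1 + i%:R * (w / 2 ^+ n.+1), p.2 + j%:R * (h / 2 ^+ n.+1)) => _;
    split => //; exists i, j.
pose f n p := projT1 (cid (next n p)).
have fP n p : Q n p -> Q n.+1 (f n p) /\
    exists i j : bool, f n p = (p.1 + i%:R * (w / 2 ^+ n.+1),
                            p.2 + j%:R * (h / 2 ^+ n.+1)).
  exact: projT2 (cid (next n p)).
pose u := fix u n := if n is m.+1 then f m (u m) else (a0, c0).
have uQ n : Q n (u n) by elim: n => [|n IH] //=; have [] := fP _ _ IH.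
have [x xP] : exists x, forall n, (u n).1 <= x <= (u n).1 + w / 2 ^+ n.
  have wn k : 0 <= w / 2 ^+ k by rewrite divr_ge0 // exprn_ge0.
  apply: (@nested_intervals w (fun n => (u n).1)) => // n /=;
    have [_ [i [j ->]]] := fP _ _ (uQ n) => /=;
    move: (half w n) (wn n.+1); move: (_ / _) (_ / _) => t t';
    by case: i => /=; rewrite ?mul1r ?mul0r; lra.
have [y yP] : exists y, forall n, (u n).2 <= y <= (u n).2 + h / 2 ^+ n.
  have wn k : 0 <= h / 2 ^+ k by rewrite divr_ge0 // exprn_ge0.
  apply: (@nested_intervals h (fun n => (u n).2)) => // n /=;
    have [_ [i [j ->]]] := fP _ _ (uQ n) => /=;
    move: (half h n) (wn n.+1); move: (_ / _) (_ / _) => t t';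
    by case: j => /=; rewrite ?mul1r ?mul0r; lra.
by exists x, y => n; exists (u n).1, (u n).2; split => //; exact: uQ.
Qed.

End NestedRectangles.

Section Goursat.
Context {R : realType}.
Implicit Types (G : R -> R -> Cx R) (a b c d m x y : R).

Lemma modulus_pair_le (x y : R) : modulus (x +i* y)%C <= `|x| + `|y|.
Proof. exact: modulus_le_ReIm. Qed.

Lemma complex_differentiable_continuous G x y : complex_differentiable G x y ->
  forall e : R, 0 < e -> exists2 d : R, 0 < d &
    forall x' y', `|x' - x| < d -> `|y' - y| < d ->
      modulus (G x' y' - G x y) < e.
Proof.
move=> [k H] e e0; have [d d0 Hd] := H 1 ltr01.
have k0 := modulus_ge0 k.
(* twice the Lipschitz constant [|k| + 1], as both increments are below [e / M] *)
pose M := 2 * (modulus k + 1).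
have M0 : 0 < M by rewrite /M; lra.
exists (Num.min d (e / M)); first by rewrite lt_min d0 divr_gt0.
move=> x' y'; rewrite !lt_min => /andP[xd xe] /andP[yd ye].
have := Hd _ _ xd yd; rewrite mul1r => H1.
apply: le_lt_trans (modulus_le_dist _ (k * ((x' - x) +i* (y' - y))%C)) _.
have H2 := modulus_pair_le (x' - x) (y' - y).
rewrite modulusM.
have : modulus k * modulus ((x' - x) +i* (y' - y))%C <=
  modulus k * (`|x' - x| + `|y' - y|) by rewrite ler_wpM2l.
move: xe ye; rewrite !ltr_pdivlMr // => xe ye H3.
move: H1 H3 xe ye; rewrite /M.
move: `|x' - x| `|y' - y| (modulus _) (modulus _ * _) => X Y A B.
nra.
Qed.

Lemma segment_continuous_horizontal G a b y :
  (forall x, a <= x <= b -> complex_differentiable G x y) ->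
  segment_continuous a b (fun x => G x y).
Proof.
move=> dG x xab e e0.
have [d d0 H] := complex_differentiable_continuous _ _ _ (dG x xab) e e0.
by exists d => // x' /H; apply; rewrite subrr normr0.
Qed.

Lemma segment_continuous_vertical G x c d :
  (forall y, c <= y <= d -> complex_differentiable G x y) ->
  segment_continuous c d (fun y => G x y).
Proof.
move=> dG y ycd e e0.
have [r r0 H] := complex_differentiable_continuous _ _ _ (dG y ycd) e e0.
by exists r => // y' /H; apply; rewrite // subrr normr0.
Qed.

Definition rectangle_differentiable G a b c d :=
  forall x y, a <= x <= b -> c <= y <= d -> complex_differentiable G x y.

Lemma path_integral_telescope a b (p q r : R -> Cx R) :
  segment_continuous a b p -> segment_continuous a b q ->
  segment_continuous a b r ->
  path_integral a b (fun x => p x - r x) =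
  path_integral a b (fun x => p x - q x) + path_integral a b (fun x => q x - r x).
Proof.
move=> cp cq cr; rewrite -path_integralD; try exact: segment_continuousB.
by congr path_integral; apply/funext => x; rewrite addrA subrK.
Qed.

Lemma rectangle_integral_splitx G a m b c d :
  a <= m -> m <= b -> c <= d -> rectangle_differentiable G a b c d ->
  rectangle_integral G a b c d =
  rectangle_integral G a m c d + rectangle_integral G m b c d.
Proof.
move=> am mb cd dG; rewrite /rectangle_integral.
have ab := le_trans am mb.
have cv x : a <= x <= b -> segment_continuous c d (fun y => G x y).
  by move=> xab; apply: segment_continuous_vertical => y; exact: dG.
have ch y : c <= y <= d -> segment_continuous a b (fun x => G x y).
  by move=> ycd; apply: segment_continuous_horizontal => x /dG; exact.
rewrite (@path_integral_split _ a m b) //; last first.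
  by apply: segment_continuousB; apply: ch; rewrite lexx cd.
rewrite (@path_integral_telescope c d (fun y => G b y) (fun y => G m y));
  [|by apply: cv; rewrite ?lexx ?ab ?am ?mb..].
ring.
Qed.

Lemma rectangle_integral_splity G a b c m d :
  a <= b -> c <= m -> m <= d -> rectangle_differentiable G a b c d ->
  rectangle_integral G a b c d =
  rectangle_integral G a b c m + rectangle_integral G a b m d.
Proof.
move=> ab cm md dG; rewrite /rectangle_integral.
have cd := le_trans cm md.
have cv x : a <= x <= b -> segment_continuous c d (fun y => G x y).
  by move=> xab; apply: segment_continuous_vertical => y; exact: dG.
have ch y : c <= y <= d -> segment_continuous a b (fun x => G x y).
  by move=> ycd; apply: segment_continuous_horizontal => x /dG; exact.
rewrite (@path_integral_split _ c m d) //; last first.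
  by apply: segment_continuousB; apply: cv; rewrite lexx ab.
rewrite (@path_integral_telescope a b (fun x => G x c) (fun x => G x m));
  [|by apply: ch; rewrite ?lexx ?cd ?cm ?md..].
ring.
Qed.

(** Replacing [G] by its first-order expansion [k] at [(x, y)] changes the
    integrand on each pair of sides by at most [2 * e * (w + h)], and the
    boundary integral of the affine part vanishes. *)
Lemma rectangle_integral_small G x y a c w h e (k : Cx R) :
  0 <= w -> 0 <= h -> 0 <= e ->
  rectangle_differentiable G a (a + w) c (c + h) ->
  a <= x <= a + w -> c <= y <= c + h ->
  (forall x' y', a <= x' <= a + w -> c <= y' <= c + h ->
     modulus (G x' y' - G x y - k * ((x' - x) +i* (y' - y))%C) <=
        e * (`|x' - x| + `|y' - y|)) ->
  modulus (rectangle_integral G a (a + w) c (c + h)) <= 4 * e * (w + h) ^+ 2.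
Proof.
move=> w0 h0 e0 dG xab ycd H.
have aw : a <= a + w by rewrite lerDl.
have ch : c <= c + h by rewrite lerDl.
have near x' y' : a <= x' <= a + w -> c <= y' <= c + h ->
    modulus (G x' y' - G x y - k * ((x' - x) +i* (y' - y))%C) <= e * (w + h).
  move=> x'ab y'cd; apply: le_trans (H _ _ x'ab y'cd) _.
  by rewrite ler_wpM2l // lerD // ler_norml; lra.
have diff2 x1 y1 x2 y2 : a <= x1 <= a + w -> c <= y1 <= c + h ->
    a <= x2 <= a + w -> c <= y2 <= c + h ->
    modulus (G x1 y1 - G x2 y2 - k * ((x1 - x2) +i* (y1 - y2))%C) <=
      2 * (e * (w + h)).
  move=> hx1 hy1 hx2 hy2.
  have -> : ((x1 - x2) +i* (y1 - y2))%C =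
      ((x1 - x) +i* (y1 - y))%C - ((x2 - x) +i* (y2 - y))%C :> Cx R.
    by apply/eqP; rewrite eq_complex /=; apply/andP; split; apply/eqP; ring.
  rewrite (_ : _ - _ - _ = (G x1 y1 - G x y - k * ((x1 - x) +i* (y1 - y))%C) -
     (G x2 y2 - G x y - k * ((x2 - x) +i* (y2 - y))%C)); last by ring.
  apply: le_trans (modulusD _ _) _; rewrite modulusN.
  by have := near _ _ hx1 hy1; have := near _ _ hx2 hy2; lra.
have cA : a <= a <= a + w by rewrite lexx aw.
have cB : a <= a + w <= a + w by rewrite lexx aw.
have cC : c <= c <= c + h by rewrite lexx ch.
have cD : c <= c + h <= c + h by rewrite lexx ch.
have cth y' : c <= y' <= c + h ->
    segment_continuous a (a + w) (fun x => G x y').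
  by move=> ?; apply: segment_continuous_horizontal => x' /dG; exact.
have ctv x' : a <= x' <= a + w ->
    segment_continuous c (c + h) (fun y => G x' y).
  by move=> ?; apply: segment_continuous_vertical => y'; exact: dG.
pose k1 : Cx R := k * (0 +i* (- h))%C.
pose k2 : Cx R := k * (w +i* 0)%C.
have := @path_integral_near_cst _ a (a + w) k1 (2 * (e * (w + h)))
  (fun x => G x c - G x (c + h)) aw (segment_continuousB _ _ _ _ (cth _ cC) (cth _ cD)).
have := @path_integral_near_cst _ c (c + h) k2 (2 * (e * (w + h)))
  (fun y => G (a + w) y - G a y) ch (segment_continuousB _ _ _ _ (ctv _ cB) (ctv _ cA)).
have n1 x' : a <= x' <= a + w -> modulus (G x' c - G x' (c + h) - k1) <=
   2 * (e * (w + h)).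
  move=> hx; have := diff2 x' c x' (c + h) hx cC hx cD.
  by rewrite subrr opprD addNKr.
have n2 y' : c <= y' <= c + h -> modulus (G (a + w) y' - G a y' - k2) <=
   2 * (e * (w + h)).
  move=> hy; have := diff2 (a + w) y' a y' cB hy cA hy.
  by rewrite subrr [a + w - a]addrC addKr.
move=> /(_ n2) I2 /(_ n1) I1; rewrite /rectangle_integral.
move: I1 I2; rewrite [a + w - a]addrC addKr [c + h - c]addrC addKr.
move: (path_integral _ _ _) (path_integral _ _ _) => J2 J1 I1 I2.
have -> : J1 + 'i * J2 =
   (J1 - ((w%:C)%C : Cx R) * k1) + 'i * (J2 - ((h%:C)%C : Cx R) * k2).
  have : ((w%:C)%C : Cx R) * k1 + 'i * (((h%:C)%C : Cx R) * k2) = 0.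
    rewrite /k1 /k2 -complexiE; case: (k) => p q; apply/eqP.
    by rewrite eq_complex /=; apply/andP; split; apply/eqP; ring.
  move=> E; rewrite -[LHS]subr0 -E; ring.
apply: le_trans (modulusD _ _) _; rewrite modulusM modulus_i mul1r.
apply: le_trans (lerD I1 I2) _; rewrite le_eqVlt; apply/orP; left; apply/eqP.
ring.
Qed.

End Goursat.

Section GoursatTheorem.
Context {R : realType}.
Implicit Types (G : R -> R -> Cx R) (a b c d m x y : R).

(** The boundary integral is the sum of those of the four quarters, so one of
    them carries at least a quarter of it. *)
Lemma rectangle_integral_quarter G a c w h : 0 <= w -> 0 <= h ->
  rectangle_differentiable G a (a + (w + w)) c (c + (h + h)) ->
  exists i j : bool,
    modulus (rectangle_integral G a (a + (w + w)) c (c + (h + h))) <=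
    4 * modulus (rectangle_integral G (a + i%:R * w) (a + i%:R * w + w)
                   (c + j%:R * h) (c + j%:R * h + h)).
Proof.
move=> w0 h0 dG.
have sub a' b' c' d' : a <= a' -> b' <= a + (w + w) -> c <= c' ->
    d' <= c + (h + h) -> rectangle_differentiable G a' b' c' d'.
  by move=> ? ? ? ? x y ? ?; apply: dG; lra.
rewrite (@rectangle_integral_splitx _ G a (a + w)); try lra; last by apply: sub; lra.
rewrite (@rectangle_integral_splity _ G a (a + w) c (c + h)); try lra;
  last by apply: sub; lra.
rewrite (@rectangle_integral_splity _ G (a + w) (a + (w + w)) c (c + h)); try lra;
  last by apply: sub; lra.
have := modulusD (rectangle_integral G a (a + w) c (c + h) +
  rectangle_integral G a (a + w) (c + h) (c + (h + h)))
  (rectangle_integral G (a + w) (a + (w + w)) c (c + h) +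
  rectangle_integral G (a + w) (a + (w + w)) (c + h) (c + (h + h))).
have := modulusD (rectangle_integral G a (a + w) c (c + h))
  (rectangle_integral G a (a + w) (c + h) (c + (h + h))).
have := modulusD (rectangle_integral G (a + w) (a + (w + w)) c (c + h))
  (rectangle_integral G (a + w) (a + (w + w)) (c + h) (c + (h + h))).
set X := modulus (_ + _ + (_ + _)).
move: (modulus (_ + _)) (modulus (_ + _)) => Y Z.
move=> YZ1 YZ2 YZ3; apply: contrapT => no.
have no' i j q := no (ex_intro _ i (ex_intro _ j q)).
have := no' true true; have := no' true false.
have := no' false true; have := no' false false => {no no'}.
rewrite !mul1r !mul0r !addr0 -!addrA.
move/negP; rewrite -ltNge => h1; move/negP; rewrite -ltNge => h2.
move/negP; rewrite -ltNge => h3; move/negP; rewrite -ltNge => h4.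
lra.
Qed.

(** If the boundary integral has modulus [eta], repeated quartering keeps it at
    least [eta / 4 ^ n], while differentiability at the limit point makes it at most
    [4 * e * (w + h) ^ 2 / 4 ^ n] for every [e > 0]. *)
Theorem goursat G a c w h : 0 <= w -> 0 <= h ->
  rectangle_differentiable G a (a + w) c (c + h) ->
  rectangle_integral G a (a + w) c (c + h) = 0.
Proof.
move=> w0 h0 dG.
pose eta := modulus (rectangle_integral G a (a + w) c (c + h)).
pose P n a' c' := [/\ a <= a', a' + w / 2 ^+ n <= a + w, c <= c',
   c' + h / 2 ^+ n <= c + h & eta <= 4 ^+ n * modulus
     (rectangle_integral G a' (a' + w / 2 ^+ n) c' (c' + h / 2 ^+ n))].
have half (z : R) n : z / 2 ^+ n = z / 2 ^+ n.+1 + z / 2 ^+ n.+1.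
  by rewrite exprS invfM mulrA mulrAC -splitr.
have wn n : 0 <= w / 2 ^+ n by rewrite divr_ge0 // exprn_ge0.
have hn n : 0 <= h / 2 ^+ n by rewrite divr_ge0 // exprn_ge0.
have P0 : P 0%N a c by rewrite /P !expr0 !divr1 mul1r !lexx.
have [|x [y xy]] := @nested_rectangles _ w h P a c w0 h0 P0.
  move=> n a' c' [aa' wa' cc' hc' le_eta].
  have [] := @rectangle_integral_quarter G a' c' _ _ (wn n.+1) (hn n.+1).
    by rewrite -!half => u v ? ?; apply: dG; lra.
  move=> i [j]; rewrite -!half => q; exists i, j; split.
  - by have := wn n.+1; case: (i) => /=; rewrite ?mul1r ?mul0r; lra.
  - have := wn n.+1; move: wa'; rewrite (half w n).
    by case: (i) => /=; rewrite ?mul1r ?mul0r; lra.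
  - by have := hn n.+1; case: (j) => /=; rewrite ?mul1r ?mul0r; lra.
  - have := hn n.+1; move: hc'; rewrite (half h n).
    by case: (j) => /=; rewrite ?mul1r ?mul0r; lra.
  - by apply: le_trans le_eta _; rewrite exprSr -mulrA ler_wpM2l ?exprn_ge0.
have xab : a <= x <= a + w.
  by have [a' [c' [[? ? ? ? _] ? _]]] := xy 0%N; lra.
have ycd : c <= y <= c + h.
  by have [a' [c' [[? ? ? ? _] _ ?]]] := xy 0%N; lra.
suff small e : 0 < e -> eta <= 4 * e * (w + h) ^+ 2.
  apply/eqP; rewrite -modulus_eq0 -/eta eq_le modulus_ge0 andbT.
  apply/ler_addgt0Pl => e e0; rewrite addr0.
  (* the 1 keeps [D] positive when the rectangle is degenerate *)
pose D := 4 * ((w + h) ^+ 2 + 1).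
  have D0 : 0 < D by rewrite /D; have := sqr_ge0 (w + h); lra.
  apply: le_trans (small _ (divr_gt0 e0 D0)) _.
  have eD : e = e / D * D by rewrite divfK ?gt_eqF.
  rewrite [leRHS]eD.
  have : 0 <= e / D by rewrite ltW // divr_gt0.
  by move: (e / D) => t; rewrite /D; move: (_ ^+ 2) => S t0; lra.
move=> e0; have [k Hk] := dG x y xab ycd; have [d d0 Hd] := Hk e e0.
have [n nd] : exists n, (w + h) / 2 ^+ n < d.
  exists (Num.bound ((w + h) / d)); rewrite ltr_pdivrMr ?exprn_gt0 // mulrC.
  rewrite -ltr_pdivrMr //.
  apply: lt_le_trans (archi_boundP _) _; first by rewrite divr_ge0 ?addr_ge0 // ltW.
  rewrite -natrX ler_nat.
  exact: ltnW (ltn_expl _ _).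
have [a' [c' [[aa' wa' cc' hc' le_eta] xa yc]]] := xy n.
apply: le_trans le_eta _.
have -> : 4 * e * (w + h) ^+ 2 =
    4 ^+ n * (4 * e * (w / 2 ^+ n + h / 2 ^+ n) ^+ 2).
  have -> : 4 ^+ n = 2 ^+ n * 2 ^+ n :> R by rewrite -exprMn -natrM.
  by field; rewrite expf_neq0.
rewrite ler_wpM2l ?exprn_ge0 //.
apply: (@rectangle_integral_small _ G x y _ _ _ _ _ k) => //; first exact: ltW.
  by move=> u v ? ?; apply: dG; lra.
move: nd; rewrite mulrDl => nd.
have := wn n; have := hn n; move: xa yc nd.
move: (w / 2 ^+ n) (h / 2 ^+ n) => wn' hn' xa yc nd h1 h2 x' y' hx hy.
by apply: Hd; rewrite ltr_norml; lra.
Qed.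

End GoursatTheorem.

(** * Mean values over circles *)

Lemma is_derive_first_order (K : numFieldType) (F : K -> K) (x D : K) :
  is_derive x 1 F D -> forall e : K, 0 < e -> exists2 d : K, 0 < d &
    forall y, `|y - x| < d -> `|F y - F x - D * (y - x)| <= e * `|y - x|.
Proof.
move=> [dF DF] e e0.
have cF : (fun h => h^-1 *: (F (h *: (1 : K^o) + x) - F x)) @ 0^' --> D.
  by rewrite -DF; exact: dF.
move/cvgrPdist_le : cF => /(_ e e0).
rewrite near_withinE => /nbhs_ballP[d /= d0 Hd]; exists d => // y yx.
have [->|yx0] := eqVneq y x; first by rewrite !subrr mulr0 subr0 !normr0 mulr0.
have yx0' : y - x != 0 by rewrite subr_eq0.
have := Hd (y - x); rewrite -ball_normE /= sub0r normrN => /(_ yx yx0').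
rewrite [_ *: 1]mulr1 subrK => H.
rewrite -ler_pdivrMr ?normr_gt0 // -normfV -normrM.
rewrite mulrBl mulfK // distrC [(F y - F x) / _]mulrC; exact: H.
Qed.

Section PolarCoordinates.
Context {R : realType}.

Lemma complex_first_order (f : Cx R -> Cx R) (z : Cx R) : differentiable f z ->
  exists k, forall e : R, 0 < e -> exists2 d : R, 0 < d &
    forall w, modulus (w - z) < d ->
      modulus (f w - f z - k * (w - z)) <= e * modulus (w - z).
Proof.
move=> /derivable1_diffP df; exists ('D_1 f z) => e e0.
have e0' := real_complex_gt0 _ e0.
have [d d0 Hd] := is_derive_first_order _ _ _ _ (derivableP df) _ e0'.
exists (modulus d) => [|w wz]; first by rewrite modulus_gt0 gt_eqF.
have := Hd w; rewrite -[d]gtr0_norm // !modulusE ltcR => /(_ wz).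
by rewrite -rmorphM /= lecR.
Qed.

(** The exponential of [x + i y]. *)
Definition polar (x y : R) : Cx R := ((expR x * cos y) +i* (expR x * sin y))%C.

Lemma modulus_polar x y : modulus (polar x y) = expR x.
Proof.
apply/eqP; rewrite -(@eqrXn2 _ 2) ?modulus_ge0 ?expR_ge0 // modulus_sqr /=.
by rewrite !exprMn -mulrDr cos2Dsin2 mulr1.
Qed.

Lemma polarD x y x' y' : polar (x + x') (y + y') = polar x y * polar x' y'.
Proof.
rewrite /polar expRD cosD sinD; apply/eqP; rewrite eq_complex /=.
by apply/andP; split; apply/eqP; ring.
Qed.

Lemma polar_period x : polar x (2 * pi) = polar x 0.
Proof. by rewrite /polar mulr_natl cos2pi sin2pi cos0 sin0. Qed.

(** The derivative of the exponential at 0, assembled from the real derivatives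
    of [expR], [cos] and [sin] at 0. *)
Lemma polar_first_order0 (e : R) : 0 < e -> exists2 d : R, 0 < d &
  forall u v, `|u| < d -> `|v| < d ->
    modulus (polar u v - 1 - (u +i* v)%C) <= e * (`|u| + `|v|).
Proof.
move=> e0; have e60 : 0 < e / 6 by rewrite divr_gt0.
have [d1 d10 H1] := is_derive_first_order _ _ _ _ (is_derive_expR 0) _ e60.
have [d2 d20 H2] := is_derive_first_order _ _ _ _ (is_derive_cos 0) _ e60.
have [d3 d30 H3] := is_derive_first_order _ _ _ _ (is_derive_sin 0) _ e60.
have [d4 d40 H4] := is_derive_first_order _ _ _ _ (is_derive_expR (0 : R)) _ ltr01.
pose d := Num.min (Num.min d1 d2) (Num.min (Num.min d3 d4) (Num.min (1 / 2) (e / 6))).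
exists d; first by rewrite !lt_min d10 d20 d30 d40 e60 divr_gt0.
move=> u v; rewrite !lt_min => /andP[/andP[u1 _] /andP[/andP[_ u4] /andP[u5 u6]]].
move=> /andP[/andP[_ v2] /andP[/andP[v3 _] _]].
have h1 : `|expR u - 1 - u| <= e / 6 * `|u|.
  by have := H1 u; rewrite subr0 expR0 mul1r; exact.
have h2 : `|cos v - 1| <= e / 6 * `|v|.
  by have := H2 v; rewrite subr0 cos0 sin0 oppr0 mul0r subr0; exact.
have h3 : `|sin v - v| <= e / 6 * `|v|.
  by have := H3 v; rewrite subr0 cos0 sin0 mul1r subr0; exact.
have h4 : `|expR u - 1 - u| <= `|u|.
  by have := H4 u; rewrite subr0 expR0 !mul1r; exact.
have h5 : `|expR u - 1| <= 2 * `|u|.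
  have := ler_normD (expR u - 1 - u) u; rewrite subrK; lra.
have h6 : `|expR u| <= 2.
  have := ler_normD (expR u - 1) 1; rewrite subrK normr1; lra.
apply: le_trans (modulus_le_ReIm _) _; rewrite /= subr0.
have -> : expR u * cos v - 1 - u = (expR u - 1 - u) + expR u * (cos v - 1) by ring.
have -> : expR u * sin v - v = expR u * (sin v - v) + v * (expR u - 1) by ring.
have := ler_normD (expR u - 1 - u) (expR u * (cos v - 1)).
have := ler_normD (expR u * (sin v - v)) (v * (expR u - 1)).
rewrite !normrM; have := normr_ge0 v; have := normr_ge0 u.
have p1 : `|expR u| * `|cos v - 1| <= 2 * (e / 6 * `|v|) by rewrite ler_pM.
have p2 : `|expR u| * `|sin v - v| <= 2 * (e / 6 * `|v|) by rewrite ler_pM.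
have p3 : `|v| * `|expR u - 1| <= `|v| * (2 * (e / 6)).
  by rewrite ler_pM //; apply: le_trans h5 _; rewrite ler_pM2l //; exact: ltW.
move: h1 p1 p2 p3.
move: (_ * `|cos v - 1|) (_ * `|sin v - v|) (`|v| * `|_|) => A B C.
move: `|_ + _ * _| `|_ - _ - _| `|_ + _| => X Y Z.
nra.
Qed.

Lemma polar_differentiable x y : complex_differentiable polar x y.
Proof.
exists (polar x y) => e e0.
have ex0 : 0 < e / expR x by rewrite divr_gt0 ?expR_gt0.
have [d d0 H] := polar_first_order0 _ ex0; exists d => // x' y' xd yd.
have := H _ _ xd yd.
have -> : polar x' y' - polar x y - polar x y * ((x' - x) +i* (y' - y))%C =
  polar x y * (polar (x' - x) (y' - y) - 1 - ((x' - x) +i* (y' - y))%C).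
  by rewrite !mulrBr -polarD !subrKC mulr1.
rewrite modulusM modulus_polar mulrAC ler_pdivlMr ?expR_gt0 //.
by rewrite mulrC.
Qed.

Lemma complex_differentiable_comp (f : Cx R -> Cx R) (G : R -> R -> Cx R) x y :
  differentiable f (G x y) -> complex_differentiable G x y ->
  complex_differentiable (fun u v => f (G u v)) x y.
Proof.
move=> /complex_first_order[k Hk] dG.
have [k' Hk'] := dG; exists (k * k') => e e0.
have k0 := modulus_ge0 k; have k'0 := modulus_ge0 k'.
pose e1 := e / 2 / (modulus k' + 1); pose e2 := e / 2 / (modulus k + 1).
have e10 : 0 < e1 by rewrite !divr_gt0 //; lra.
have e20 : 0 < e2 by rewrite !divr_gt0 //; lra.
have [d1 d10 H1] := Hk _ e10.
have [d2 d20 H2] := complex_differentiable_continuous _ _ _ dG _ d10.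
have [d3 d30 H3] := Hk' _ e20; have [d4 d40 H4] := Hk' _ ltr01.
exists (Num.min d2 (Num.min d3 d4)); first by rewrite !lt_min d20 d30 d40.
move=> x' y'; rewrite !lt_min => /and3P[x2 x3 x4] /and3P[y2 y3 y4].
have := H1 _ (H2 _ _ x2 y2); have := H3 _ _ x3 y3; have := H4 _ _ x4 y4.
set z := (_ +i* _)%C; rewrite mul1r => B4 B3 B1.
have zL : modulus z <= `|x' - x| + `|y' - y| by exact: modulus_pair_le.
move: B4 B3 B1 zL; set L := `|x' - x| + `|y' - y| => B4 B3 B1 zL.
have L0 : 0 <= L by rewrite addr_ge0.
have B5 : modulus (G x' y' - G x y) <= (modulus k' + 1) * L.
  apply: le_trans (modulus_le_dist _ (k' * z)) _; rewrite modulusM mulrDl mul1r.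
  by rewrite lerD // ler_wpM2l.
have -> : f (G x' y') - f (G x y) - k * k' * z =
  (f (G x' y') - f (G x y) - k * (G x' y' - G x y)) +
  k * (G x' y' - G x y - k' * z) by ring.
apply: le_trans (modulusD _ _) _; rewrite modulusM [e]splitr mulrDl lerD //.
  apply: le_trans B1 _; apply: le_trans (ler_wpM2l (ltW e10) B5) _.
  by rewrite mulrA divfK // gt_eqF //; lra.
apply: le_trans (ler_wpM2l k0 B3) _; rewrite mulrA ler_wpM2r //.
rewrite mulrC -mulrA -[leRHS]mulr1 ler_wpM2l //; first by rewrite divr_ge0 // ltW.
by rewrite mulrC ler_pdivrMr ?mul1r; lra.
Qed.

(** In logarithmic polar coordinates the annulus between a small radius and [r]
    is a rectangle of height [2 * pi].  Goursat's theorem and periodicity show that the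
    integrals over the two circles agree; on the small circle the function is
    close to [f 0]. *)
Lemma modulus_center_le (f : Cx R -> Cx R) (r M : R) : 0 < r < 1 ->
  (forall z, `|z| < 1 -> differentiable f z) ->
  (forall z, modulus z = r -> modulus (f z) <= M) ->
  modulus (f 0) <= 2 * M.
Proof.
move=> /andP[r0 r1] df fM.
have pi0 : 0 < 2 * pi :> R by rewrite mulr_gt0 // pi_gt0.
suff H e : 0 < e -> modulus (f 0) <= 2 * (M + e).
  apply/ler_addgt0Pr => e e0; have e20 : 0 < e / 2 by rewrite divr_gt0.
  by have := H _ e20; lra.
move=> e0.
have [k Hk] : exists k, forall e : R, 0 < e -> exists2 d : R, 0 < d &
    forall w, modulus (w - 0) < d ->
      modulus (f w - f 0 - k * (w - 0)) <= e * modulus (w - 0).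
  by apply: complex_first_order; apply: df; rewrite normr0.
have [d d0 Hd] := Hk 1 ltr01; have k0 := modulus_ge0 k.
pose t := Num.min (d / 2) (Num.min r (e / (modulus k + 1))).
have t0 : 0 < t by rewrite !lt_min !divr_gt0 // ?r0 //; lra.
have td : t < d by rewrite !gt_min; apply/orP; left; lra.
have tr : t <= r by rewrite !ge_min lexx orbT.
have te : (modulus k + 1) * t <= e.
  by rewrite mulrC -ler_pdivlMr ?ge_min ?lexx ?orbT //; lra.
have near0 z : modulus z = t -> modulus (f z - f 0) <= e.
  move=> zt; have := Hd z; rewrite subr0 zt mul1r => /(_ td) H.
  apply: le_trans (modulus_le_dist _ (k * z)) _; rewrite modulusM zt.
  by move: te; rewrite mulrDl mul1r; lra.
pose G x y := f (polar x y).
have dG x y : x < 0 -> complex_differentiable G x y.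
  move=> x0; apply: complex_differentiable_comp; last exact: polar_differentiable.
  by apply: df; rewrite normr_lt1 modulus_polar expR_lt1.
have lnr : ln r < 0 by rewrite ln_lt0 // r0.
have lntr : ln t <= ln r by rewrite ler_ln.
have /goursat : 0 <= ln r - ln t by rewrite subr_ge0.
move=> /(_ G (ln t) 0 (2 * pi) (ltW pi0)).
rewrite subrKC add0r => H.
have {H} : rectangle_integral G (ln t) (ln r) 0 (2 * pi) = 0.
  by apply: H => x y /andP[_ xr] _; apply: dG; exact: le_lt_trans lnr.
have cG x : x <= ln r -> segment_continuous 0 (2 * pi) (fun y => G x y).
  move=> xr; apply: segment_continuous_vertical => y _.
  by apply: dG; exact: le_lt_trans lnr.
rewrite /rectangle_integral.
have -> : path_integral (ln t) (ln r) (fun x => G x 0 - G x (2 * pi)) = 0.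
  apply/eqP; rewrite -modulus_eq0 eq_le modulus_ge0 andbT.
  have := @path_integral_near_cst _ (ln t) (ln r) 0 0
    (fun x => G x 0 - G x (2 * pi)) lntr.
  rewrite !mulr0 subr0; apply.
    apply: segment_continuousB; apply: segment_continuous_horizontal => x /andP[_ xr];
      by apply: dG; exact: le_lt_trans lnr.
  by move=> x _; rewrite /G polar_period !subrr modulus0.
rewrite add0r => /eqP; rewrite mulf_eq0 (negbTE (neq0Ci _)) /= => /eqP I0.
(* the difference of the two circle integrals is 0, while its integrand is
   within [M + e] of the constant [- f 0] *)
have := @path_integral_near_cst _ 0 (2 * pi) (- f 0) (M + e)
  (fun y => G (ln r) y - G (ln t) y) (ltW pi0)
  (segment_continuousB _ _ _ _ (cG _ (lexx _)) (cG _ lntr)).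
rewrite I0 !subr0 sub0r modulusN modulusM modulusN modulus_real.
rewrite gtr0_norm // mulrCA ler_pM2l //; apply => y _.
have -> : G (ln r) y - G (ln t) y - - f 0 = G (ln r) y - (G (ln t) y - f 0) by ring.
apply: le_trans (modulusD _ _) _; rewrite modulusN lerD //.
- by apply: fM; rewrite modulus_polar lnK // posrE.
- by apply: near0; rewrite modulus_polar lnK // posrE.
Qed.

End PolarCoordinates.

(** * Moebius maps of the disk *)

Section Moebius.
Context {R : realType}.
Implicit Types (a s t u v z : Cx R).

(** This identity says at once that a Moebius map preserves the disk and the
    circle. *)
Lemma modulus_mobius a z :
  modulus (1 - a^* * z) ^+ 2 - modulus (z - a) ^+ 2 =
  (1 - modulus a ^+ 2) * (1 - modulus z ^+ 2).
Proof.
by rewrite !modulus_sqr; case: a => a1 a2; case: z => z1 z2 /=; ring.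
Qed.

Lemma mobius_le1 a z : modulus a <= 1 -> modulus z <= 1 ->
  modulus (z - a) <= modulus (1 - a^* * z).
Proof.
move=> a1 z1; rewrite -ler_sqr ?nnegrE ?modulus_ge0 // -subr_ge0 modulus_mobius.
by rewrite mulr_ge0 // subr_ge0 expr_le1 // modulus_ge0.
Qed.

Lemma mobius_lt1 a z : modulus a < 1 -> modulus z < 1 ->
  modulus (z - a) < modulus (1 - a^* * z).
Proof.
move=> a1 z1; rewrite -ltr_sqr ?nnegrE ?modulus_ge0 // -subr_gt0 modulus_mobius.
by rewrite mulr_gt0 // subr_gt0 expr_lt1 // modulus_ge0.
Qed.

Lemma mobius_denom_neq0 a z : modulus a < 1 -> modulus z <= 1 -> 1 - a^* * z != 0.
Proof.
move=> a1 z1; rewrite subr_eq0; apply/eqP => /(congr1 modulus).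
rewrite modulus1 modulusM modulusJ => E.
by have := modulus_ge0 a; have := modulus_ge0 z; nra.
Qed.

(** A multiplicative constant is invisible to [n]-th powers, by Bernoulli's
    inequality. *)
Lemma ler_of_ler_expr (c x y : R) : 0 < c -> 0 < y -> 0 <= x ->
  (forall n, c * x ^+ n <= 2 * y ^+ n) -> x <= y.
Proof.
move=> c0 y0 x0 H; rewrite leNgt; apply/negP => yx.
pose q := x / y - 1; have q0 : 0 < q by rewrite subr_gt0 ltr_pdivlMr ?mul1r.
have bern n : 1 + n%:R * q <= (x / y) ^+ n.
  elim: n => [|n IH]; first by rewrite mul0r addr0 expr0.
  have -> : x / y = 1 + q by rewrite /q subrKC.
  rewrite exprS; move: IH; rewrite [x / y](_ : _ = 1 + q); last by rewrite /q subrKC.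
  have : 0 <= n%:R :> R by []; rewrite -natr1.
  by move: (n%:R) ((1 + q) ^+ n) => m p m0 IH; nra.
(* large enough for [c * (1 + n * q) > 2], against the bound at [n] *)
pose n := Num.bound (2 / (c * q)).
have bn : 2 < n%:R * (c * q).
  rewrite -ltr_pdivrMr ?mulr_gt0 //; apply: archi_boundP.
  by rewrite divr_ge0 // ltW // mulr_gt0.
have : c * (x / y) ^+ n <= 2 by rewrite expr_div_n mulrA ler_pdivrMr ?exprn_gt0.
by have := bern n; move: ((x / y) ^+ n) (n%:R) bn => p m; nra.
Qed.

End Moebius.

(** * Schwarz's lemma *)

Lemma differentiable_mulf (K : numFieldType) (f g : K -> K) (x : K) :
  differentiable f x -> differentiable g x -> differentiable (fun y => f y * g y) x.
Proof. exact: differentiableM. Qed.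

Lemma differentiable_expr (K : numFieldType) (f : K -> K) (x : K) n :
  differentiable f x -> differentiable (fun y => f y ^+ n) x.
Proof.
move=> df; case: n => [|n]; first exact: differentiable_cst.
by have := differentiableX n df; rewrite exprfctE.
Qed.

Lemma differentiable_divf (K : numFieldType) (f g : K -> K) (x : K) : g x != 0 ->
  differentiable f x -> differentiable g x -> differentiable (fun y => f y / g y) x.
Proof.
by move=> gx df dg; apply: differentiable_mulf => //; exact: differentiableV.
Qed.

Lemma differentiable_affine (K : numFieldType) (p q : K) (x : K) :
  differentiable (fun y => p + q * y) x.
Proof.
apply: (@differentiableD _ _ _ (fun=> p) (fun y => q * y)).
  exact: differentiable_cst.
apply: differentiable_mulf; first exact: differentiable_cst.
by apply/derivable1_diffP; exact: derivable_id.
Qed.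

(** At [s] the difference quotient of the function is the product of a
    difference quotient of [k] and of a function with a limit: multiplying the
    quotient by one more factor [k] removes its singularity, with no appeal to
    a removable singularity theorem.  At [z = s] the division by 0 gives 0,
    which is the value wanted there since [k s = 0]. *)
Lemma differentiable_removable (K : numFieldType) (k c : K -> K) (s : K) (n : nat) :
  differentiable k s -> differentiable c s -> k s = 0 ->
  differentiable (fun z => k z * (k z * c z / (z - s)) ^+ n) s.
Proof.
move=> dk dc ks; apply/derivable1_diffP.
pose D h : K := h^-1 * k (h + s).
have scale1 (h : K^o) : h *: (1 : K^o) = h by exact: mulr1.
have cD : D h @[h --> 0^'] --> 'D_1 k s.
  have := (derivable1_diffP _ _).2 dk; rewrite /derivable /derive.
  have -> // : (fun h => h^-1 *: ((k \o shift s) (h *: (1 : K^o)) - k s)) = D.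
  by apply/funext => h; rewrite /= ks subr0 scale1.
have cc : c (h + s) @[h --> 0^'] --> c s.
  exact: ((continuous_withinNshiftx _ _).2 (differentiable_continuous dc)).
pose l := 'D_1 k s * ('D_1 k s * c s) ^+ n.
have cl : D h * (D h * c (h + s)) ^+ n @[h --> 0^'] --> l.
  apply: cvgM => //; elim: n {l} => [|n IH].
    by apply: cvg_cst.
  under eq_fun do rewrite exprS.
  by rewrite exprS; apply: cvgM => //; exact: cvgM.
apply/cvg_ex; exists l; apply: cvg_trans cl; apply: near_eq_cvg.
near=> h; have h0 : h != 0 by near: h; exact: nbhs_dnbhs_neq.
rewrite /= scale1 ks mul0r subr0 addrK /D /GRing.scale /=.
by rewrite mulrA; congr (_ * _ ^+ n); rewrite [RHS]mulrC mulrA.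
Unshelve. all: by end_near. Qed.

Section SchwarzLemma.
Context {R : realType}.
Implicit Types (a s t u v z : Cx R).

(** On the circle of radius [r], [r * |1 - s^* z| = |z - r ^ 2 s|], which is
    within [|s| * (1 - r ^ 2)] of [|z - s|]; so the inverse of the Moebius map
    vanishing at [s] is bounded there by a quantity that tends to 1 with [r]. *)
Lemma mobius_quotient_le s z (r : R) : modulus s < r < 1 -> modulus z = r ->
  modulus (1 - s^* * z) / modulus (z - s) <=
    (1 + modulus s * (1 - r ^+ 2) / (r - modulus s)) / r.
Proof.
move=> /andP[sr r1] zr.
have s0 := modulus_ge0 s; have r0 : 0 < r by exact: le_lt_trans sr.
have rs0 : 0 < r - modulus s by rewrite subr_gt0.
have zs : r - modulus s <= modulus (z - s).
  by have := modulus_le_dist z s; rewrite zr; lra.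
have zs0 : 0 < modulus (z - s) by exact: lt_le_trans zs.
have s1 : 0 <= modulus s * (1 - r ^+ 2).
  by rewrite mulr_ge0 // subr_ge0 expr_le1 ?ltW.
have refl : modulus (1 - s^* * z) * r <=
    modulus (z - s) + modulus s * (1 - r ^+ 2).
  have zz : ((r ^+ 2)%:C)%C = z * z^* by rewrite -zr modulus_sqrJ.
  have -> : modulus (1 - s^* * z) * r =
      modulus ((z - s) + s * ((1 - r ^+ 2)%:C)%C).
    rewrite -[X in _ * X]zr -[X in X * _]modulusJ -modulusM; congr modulus.
    by rewrite !rmorphB rmorphM /= conjCK !rmorph1 zz; ring.
  apply: le_trans (modulusD _ _) _; rewrite modulusM modulus_real ger0_norm //.
  by rewrite subr_ge0 expr_le1 ?ltW.
rewrite ler_pdivlMr // mulrAC ler_pdivrMr //.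
apply: le_trans refl _; rewrite mulrDl mul1r lerD2l.
by rewrite mulrAC ler_pdivlMr // ler_wpM2l.
Qed.

(** Schwarz's lemma seen from the point 0 instead of from the zero [s]:
    [modulus_center_le] for [k * (k / m) ^ n], with [m] the Moebius map vanishing
    at [s], gives [|k 0| * (|k 0| / |s|) ^ n <= 2 * (q r) ^ n] for all [n], and
    [q r] tends to 1. *)
Lemma schwarz_center (k : Cx R -> Cx R) s :
  (forall z, `|z| < 1 -> differentiable k z) ->
  (forall z, `|z| < 1 -> modulus (k z) <= 1) ->
  modulus s < 1 -> k s = 0 -> modulus (k 0) <= modulus s.
Proof.
move=> dk k1 s1 ks.
have [s00|s0] := eqVneq s 0; first by rewrite s00 in ks *; rewrite ks.
have sp : 0 < modulus s by rewrite modulus_gt0.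
have [k00|k0] := eqVneq (k 0) 0; first by rewrite k00 modulus0 modulus_ge0.
have kp : 0 < modulus (k 0) by rewrite modulus_gt0.
pose c z := 1 - s^* * z.
have dc z : differentiable c z.
  have := differentiable_affine _ 1 (- s^*) z.
  by rewrite (_ : (fun y => _) = c) //; apply/funext => y; rewrite /c mulNr.
have dsub z : differentiable (fun z => z - s) z.
  have := differentiable_affine _ (- s) 1 z.
  by rewrite (_ : (fun y => _) = (fun z => z - s)) //; apply/funext => y;
    rewrite mul1r addrC.
pose F n z := k z * (k z * c z / (z - s)) ^+ n.
have dF n z : `|z| < 1 -> differentiable (F n) z.
  move=> z1; have [->|zs] := eqVneq z s.
    by apply: differentiable_removable => //; apply: dk; rewrite normr_lt1.
  apply: differentiable_mulf; first exact: dk.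
  apply: differentiable_expr; apply: differentiable_divf => //.
    by rewrite subr_eq0.
  by apply: differentiable_mulf => //; exact: dk.
(* bounds the inverse of [m] on the circle of radius [r]; tends to 1 with [r] *)
pose q r := (1 + modulus s * (1 - r ^+ 2) / (r - modulus s)) / r.
have key r : modulus s < r < 1 -> modulus (k 0) / modulus s <= q r.
  move=> sr1; have /andP[sr r1] := sr1; have r0 := lt_trans sp sr.
  have q0 : 0 < q r.
    have ss : 0 <= modulus s * (1 - r ^+ 2).
      by rewrite mulr_ge0 ?(ltW sp) // subr_ge0 expr_le1 ?ltW.
    by rewrite divr_gt0 // ltr_pwDl // divr_ge0 // subr_ge0 ltW.
  apply: (@ler_of_ler_expr _ (modulus (k 0))) => //; first by rewrite divr_ge0 // ltW.
  move=> n; have -> : modulus (k 0) * (modulus (k 0) / modulus s) ^+ n =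
      modulus (F n 0).
    rewrite /F /c mulr0 subr0 mulr1 sub0r modulusM modulusX modulus_div.
    by rewrite modulusN.
  apply: (@modulus_center_le _ (F n) r); [by rewrite r0|exact: dF|].
  move=> z zr; have z1 : `|z| < 1 by rewrite normr_lt1 zr.
  have ratio : modulus (k z * c z / (z - s)) <= q r.
    rewrite -mulrA modulusM -[q r]mul1r; apply: ler_pM; rewrite ?modulus_ge0 ?k1 //.
    by rewrite modulus_div; exact: mobius_quotient_le.
  rewrite /F modulusM modulusX -[_ ^+ n in leRHS]mul1r.
  apply: ler_pM; rewrite ?exprn_ge0 ?modulus_ge0 ?k1 //.
  by apply: lerXn2r; rewrite // nnegrE ?modulus_ge0 // ltW.
rewrite leNgt; apply/negP => sk.
pose rho := modulus (k 0) / modulus s.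
have rho1 : 1 < rho by rewrite ltr_pdivlMr // mul1r.
(* for [r = 1 - x], [rho * r >= (rho + 1) / 2] and [1 - r ^ 2 <= 2 * x], and
   [x] is small enough for this to contradict [key] at [r] *)
pose x := Num.min (Num.min ((rho - 1) / 2 / rho) ((1 - modulus s) / 2))
  ((rho - 1) * (1 - modulus s) / 16).
have s10 : 0 < 1 - modulus s by rewrite subr_gt0.
have rho10 : 0 < rho - 1 by rewrite subr_gt0.
have x0 : 0 < x by rewrite !lt_min !divr_gt0 ?mulr_gt0 //; lra.
have x1 : x <= (rho - 1) / 2 / rho by rewrite !ge_min lexx.
have x2 : x <= (1 - modulus s) / 2 by rewrite !ge_min lexx orbT.
have x3 : x <= (rho - 1) * (1 - modulus s) / 16 by rewrite !ge_min lexx orbT.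
have := key (1 - x); rewrite -/rho /q.
have xs : 0 < 1 - x - modulus s by lra.
have -> : modulus s < 1 - x < 1 by apply/andP; split; lra.
move=> /(_ isT); rewrite ler_pdivlMr; last by lra.
rewrite -lerBlDl ler_pdivlMr // => H.
move: x1; rewrite ler_pdivlMr; last by lra.
move: (modulus s) rho x s1 sp rho1 s10 rho10 x0 x2 x3 xs H => sg rh y.
clear => s1 sp rho1 s10 rho10 x0 x2 x3 xs H x1.
have h1 : (rh - 1) / 2 <= rh * (1 - y) - 1 by lra.
have h2 : (1 - sg) / 2 <= 1 - y - sg by lra.
have h3 : (rh - 1) / 2 * ((1 - sg) / 2) <= (rh * (1 - y) - 1) * (1 - y - sg).
  by rewrite ler_pM //; lra.
have h4 : sg * (1 - (1 - y) ^+ 2) <= 2 * y by nra.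
have : 0 < (rh - 1) * (1 - sg) by rewrite mulr_gt0.
lra.
Qed.

End SchwarzLemma.

(** * The Schwarz-Pick inequality *)

Section SchwarzPick.
Context {R : realType}.
Implicit Types (g : Cx R -> Cx R) (s t u v z : Cx R).

Lemma mobius_denomC s t : modulus (1 - t^* * s) = modulus (1 - s^* * t).
Proof.
by rewrite -[LHS]modulusJ rmorphB rmorphM /= conjCK rmorph1 [t * _]mulrC.
Qed.

(** [schwarz_center] for [g] conjugated by the Moebius maps sending 0 to [t] and
    [g s] to 0.  The strict bound on [g] keeps the second one defined. *)
Lemma schwarz_pick_strict g s t :
  (forall z, `|z| < 1 -> differentiable g z) ->
  (forall z, `|z| < 1 -> modulus (g z) < 1) -> modulus s < 1 -> modulus t < 1 ->
  modulus (g s - g t) * modulus (1 - s^* * t) <=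
  modulus (s - t) * modulus (1 - (g s)^* * g t).
Proof.
move=> dg g1 s1 t1.
pose M z := (t + 1 * z) / (1 + t^* * z).
pose sg := (s - t) / (1 - t^* * s).
have tn0 z : modulus z < 1 -> 1 + t^* * z != 0.
  move=> z1; have := @mobius_denom_neq0 _ (- t) z.
  by rewrite rmorphN mulNr opprK modulusN; apply => //; exact: ltW.
have st0 : 1 - t^* * s != 0 by apply: mobius_denom_neq0 => //; exact: ltW.
have tt0 : 1 - t^* * t != 0 by apply: mobius_denom_neq0 => //; exact: ltW.
have M1 z : modulus z < 1 -> modulus (M z) < 1.
  move=> z1; rewrite /M !mul1r modulus_div ltr_pdivrMr ?modulus_gt0 ?tn0 // mul1r.
  have := @mobius_lt1 _ (- t) z; rewrite rmorphN mulNr !opprK modulusN.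
  by rewrite [t + z]addrC; exact.
have sg1 : modulus sg < 1.
  by rewrite modulus_div ltr_pdivrMr ?modulus_gt0 // mul1r; exact: mobius_lt1.
have Msg : M sg = s.
  have d0 := tn0 _ sg1; move: d0; rewrite /M /sg => d0.
  have E : 1 + t^* * ((s - t) / (1 - t^* * s)) = (1 - t^* * t) / (1 - t^* * s).
    by field.
  by rewrite E; field; rewrite tt0 andbT; exact: st0.
pose u := g s.
have u1 : modulus u < 1 by apply: g1; rewrite normr_lt1.
pose k z := (- u + 1 * g (M z)) / (1 + - u^* * g (M z)).
have dn z : modulus z < 1 -> 1 + - u^* * g (M z) != 0.
  move=> z1; rewrite mulNr; apply: mobius_denom_neq0 => //.
  by apply/ltW/g1; rewrite normr_lt1 M1.
have dgM z : `|z| < 1 -> differentiable (fun z => g (M z)) z.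
  rewrite normr_lt1 => z1; apply: differentiable_comp.
    by apply: differentiable_divf; [exact: tn0|exact: differentiable_affine..].
  by apply: dg; rewrite normr_lt1 M1.
have dk z : `|z| < 1 -> differentiable k z.
  move=> z1; apply: differentiable_divf; first by apply: dn; rewrite -normr_lt1.
    exact: (differentiable_comp (dgM z z1) (differentiable_affine _ (- u) 1 _)).
  exact: (differentiable_comp (dgM z z1) (differentiable_affine _ 1 (- u^* ) _)).
have k1 z : `|z| < 1 -> modulus (k z) <= 1.
  rewrite normr_lt1 => z1; rewrite modulus_div ler_pdivrMr ?modulus_gt0 ?dn //.
  rewrite !mul1r mulNr addrC; apply: mobius_le1; first exact: ltW.
  by apply/ltW/g1; rewrite normr_lt1 M1.
have ks : k sg = 0 by rewrite /k Msg mul1r addNr mul0r.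
have := schwarz_center _ _ dk k1 sg1 ks.
have M0 : M 0 = t by rewrite /M !mulr0 !addr0 divr1.
rewrite /k M0 mul1r mulNr [- u + _]addrC !modulus_div -/u.
have g1t : 0 < modulus (1 - u^* * g t).
  by rewrite modulus_gt0 mobius_denom_neq0 //; apply/ltW/g1; rewrite normr_lt1.
rewrite ler_pdivrMr // mulrAC ler_pdivlMr ?modulus_gt0 //.
by rewrite mobius_denomC [modulus (g t - u)]modulusB.
Qed.

(** Apply [schwarz_pick_strict] to [c * g] and let [c] tend to 1; the product
    form of the inequality makes the limit harmless even when
    [1 - (g s)^* * g t] vanishes. *)
Lemma schwarz_pick_disk g s t :
  (forall z, `|z| < 1 -> differentiable g z) ->
  (forall z, `|z| < 1 -> modulus (g z) <= 1) -> modulus s < 1 -> modulus t < 1 ->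
  modulus (g s - g t) * modulus (1 - s^* * t) <=
  modulus (s - t) * modulus (1 - (g s)^* * g t).
Proof.
move=> dg g1 s1 t1.
have scaled (c : R) : 0 < c < 1 ->
    c * (modulus (g s - g t) * modulus (1 - s^* * t)) <=
    modulus (s - t) * (modulus (1 - (g s)^* * g t) + (1 - c ^+ 2)).
  move=> /andP[c0 c1]; pose cC : Cx R := (c%:C)%C; pose gc z := cC * g z.
  have mc : modulus cC = c by rewrite modulus_real gtr0_norm.
  have dgc z : `|z| < 1 -> differentiable gc z.
    by move=> /dg; apply: differentiable_mulf; exact: differentiable_cst.
  have gc1 z : `|z| < 1 -> modulus (gc z) < 1.
    by move=> /g1; rewrite modulusM mc; nra.
  have := schwarz_pick_strict _ _ _ dgc gc1 s1 t1.
  rewrite /gc -mulrBr modulusM mc => H.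
  rewrite mulrA; apply: le_trans H _; apply: ler_wpM2l; first exact: modulus_ge0.
  have -> : 1 - (cC * g s)^* * (cC * g t) =
     (1 - (g s)^* * g t) + (((1 - c ^+ 2)%:C)%C : Cx R) * ((g s)^* * g t).
    rewrite rmorphM rmorphB rmorphXn rmorph1 /=.
    have -> : cC^* = cC by exact: conjc_real.
    rewrite -/cC.
    ring.
  apply: le_trans (modulusD _ _) _; rewrite lerD2l modulusM modulus_real.
  have c2 : 0 <= 1 - c ^+ 2 by rewrite subr_ge0 expr_le1 ?ltW.
  rewrite ger0_norm // -[leRHS]mulr1 ler_wpM2l // modulusM modulusJ.
  by rewrite mulr_ile1 ?modulus_ge0 ?g1 ?normr_lt1.
have := modulus_ge0 (s - t); have := modulus_ge0 (1 - s^* * t).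
have := modulus_ge0 (g s - g t); have := modulus_ge0 (1 - (g s)^* * g t).
move: scaled; move: (modulus (g s - g t)) (modulus (1 - s^* * t)).
move: (modulus (s - t)) (modulus (1 - (g s)^* * g t)) => D X A B.
move=> H X0 A0 B0 D0; apply/ler_addgt0Pr => e e0.
have AB : 0 <= A * B by rewrite mulr_ge0.
(* with [c = 1 - y], both error terms are at most [2 * D * y] and [A * B * y] *)
pose N := A * B + 2 * D + e; have N0 : 0 < N by rewrite /N; nra.
pose y := e / (2 * N).
have yN : y * (2 * N) = e by rewrite divfK // gt_eqF // mulr_gt0.
have y0 : 0 < y by rewrite divr_gt0 // mulr_gt0.
have y1 : y < 1 by rewrite ltr_pdivrMr ?mulr_gt0 // mul1r /N; nra.
have := H (1 - y); have -> : 0 < 1 - y < 1 by apply/andP; split; lra.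
move=> /(_ isT); move: AB yN; rewrite /N; move: (A * B) => C C0 yN H1.
have : D * y ^+ 2 >= 0 by rewrite mulr_ge0 // sqr_ge0.
have : 0 <= y * e by rewrite mulr_ge0 // ltW.
have : 0 <= y * C by rewrite mulr_ge0 // ltW.
have : 0 <= y * D by rewrite mulr_ge0 // ltW.
nra.
Qed.

Lemma pseudo_hyperbolicE u v :
  pseudo_hyperbolic u v = ((modulus (u - v) / modulus (1 - u^* * v))%:C)%C.
Proof. by rewrite /pseudo_hyperbolic modulusE modulus_div. Qed.

(** Pulling [f] back to an analytic disk through [a] and [b] reduces the
    two-variable inequality to the one-variable one. *)
Lemma schwarz_pick_along_disk (f : C2 R -> Cx R) (gam : Cx R -> C2 R)
    (a b : C2 R) s t :
  (forall z, `|z| < 1 -> differentiable (fun z => f (gam z)) z) ->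
  (forall z, `|z| < 1 -> `|f (gam z)| <= 1) ->
  `|s| < 1 -> `|t| < 1 -> gam s = a -> gam t = b ->
  pseudo_hyperbolic s t <=
    Num.max (pseudo_hyperbolic a.1 b.1) (pseudo_hyperbolic a.2 b.2) ->
  schwarz_pick f a b.
Proof.
rewrite !normr_lt1 => dg g1 s1 t1 <- <- stmax.
have g1' z : `|z| < 1 -> modulus (f (gam z)) <= 1 by move=> /g1; rewrite normr_le1.
have H := schwarz_pick_disk (fun z => f (gam z)) _ _ dg g1' s1 t1.
have st0 : 0 < modulus (1 - s^* * t).
  by rewrite modulus_gt0 mobius_denom_neq0 // ltW.
split.
  move=> E; apply/eqP; rewrite -modulus_eq0 eq_le modulus_ge0 andbT.
  by move: H; rewrite E modulus0 mulr0 pmulr_lle0.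
apply: le_trans stmax; rewrite !pseudo_hyperbolicE lecR.
have [->|n0] := eqVneq (1 - (f (gam s))^* * f (gam t)) 0.
  by rewrite modulus0 invr0 mulr0 divr_ge0 // modulus_ge0.
rewrite ler_pdivrMr ?modulus_gt0 // mulrAC ler_pdivlMr //.
Qed.

End SchwarzPick.

(** * Blaschke products *)

Section Blaschke.
Context {R : realType}.
Implicit Types (P Q : {poly Cx R}) (s t u v z w : Cx R).

(** [P / Q] behaves like a finite Blaschke product, possibly with common factors.
    Keeping numerator and denominator apart gives the equation of the graph. *)
Definition blaschke_pair P Q : Prop := forall z,
  (modulus z < 1 -> modulus P.[z] < modulus Q.[z]) /\
  (modulus z = 1 -> modulus P.[z] = modulus Q.[z] /\ Q.[z] != 0).

Lemma blaschke_pair_factor s : modulus s < 1 ->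
  blaschke_pair ('X - s%:P) (1 - s^* *: 'X).
Proof.
move=> s1 z; rewrite !hornerE; split => z1; first exact: mobius_lt1.
split; last by apply: mobius_denom_neq0; rewrite ?z1.
apply/eqP; rewrite -(@eqrXn2 _ 2) ?modulus_ge0 // eq_sym -subr_eq0.
by rewrite modulus_mobius z1 expr1n subrr mulr0.
Qed.

Lemma blaschke_pairZ P Q w : modulus w = 1 -> blaschke_pair P Q ->
  blaschke_pair (w *: P) Q.
Proof. by move=> w1 PQ z; rewrite hornerZ modulusM w1 mul1r; exact: PQ. Qed.

Lemma blaschke_pairM P Q P' Q' : blaschke_pair P Q -> blaschke_pair P' Q' ->
  blaschke_pair (P * P') (Q * Q').
Proof.
move=> PQ PQ' z; rewrite !hornerM !modulusM; split => z1.
  by apply: ltr_pM; rewrite ?modulus_ge0 //; [apply (PQ z).1|apply (PQ' z).1].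
have [-> q0] := (PQ z).2 z1; have [-> q0'] := (PQ' z).2 z1.
by rewrite mulf_neq0.
Qed.

(** Composition of [P / Q] with the Moebius map sending 0 to [w]. *)
Lemma blaschke_pair_mobius P Q w : modulus w < 1 -> blaschke_pair P Q ->
  blaschke_pair (P + w *: Q) (Q + w^* *: P).
Proof.
move=> w1 PQ z; rewrite !hornerE.
have E : modulus (Q.[z] + w^* * P.[z]) ^+ 2 - modulus (P.[z] + w * Q.[z]) ^+ 2 =
    (1 - modulus w ^+ 2) * (modulus Q.[z] ^+ 2 - modulus P.[z] ^+ 2).
  rewrite !modulus_sqr; case: P.[z] => p p'; case: Q.[z] => q q'.
  by case: (w) => x y /=; ring.
split => z1.
  rewrite -ltr_sqr ?nnegrE ?modulus_ge0 // -subr_gt0 E mulr_gt0 // subr_gt0.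
    by rewrite expr_lt1 ?modulus_ge0.
  by rewrite ltr_sqr ?nnegrE ?modulus_ge0 //; exact: (PQ z).1.
have [PQz Q0] := (PQ z).2 z1; split.
  apply/eqP; rewrite -(@eqrXn2 _ 2) ?modulus_ge0 // eq_sym -subr_eq0.
  by rewrite E PQz subrr mulr0.
rewrite addr_eq0; apply/eqP => /(congr1 modulus).
rewrite modulusN modulusM modulusJ PQz => /eqP.
have q0 : 0 < modulus Q.[z] by rewrite modulus_gt0.
by rewrite -subr_eq0 -{1}[modulus Q.[z]]mul1r -mulrBl mulf_eq0 subr_eq0
  gt_eqF //= gt_eqF.
Qed.

(** After Moebius maps sending [s] and [u] to 0, the product must send 0 to 0
    and [be] to [b2], that is, be [z * chi z] with [chi be = ga = b2 / be] and
    [|ga| <= 1].  If [|ga| = 1], take the constant [ga] for [chi]; otherwise a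
    Moebius map vanishing at the second node, followed by the one that sends 0
    to [ga]. *)
Lemma blaschke_interpolation s t u v :
  modulus s < 1 -> modulus t < 1 -> modulus u < 1 -> modulus v < 1 ->
  modulus (v - u) / modulus (1 - u^* * v) <=
    modulus (t - s) / modulus (1 - s^* * t) ->
  exists P Q, [/\ blaschke_pair P Q, P.[s] = u * Q.[s] & P.[t] = v * Q.[t]].
Proof.
move=> s1 t1 u1 v1; rewrite -!modulus_div.
pose be := (t - s) / (1 - s^* * t).
pose b2 := (v - u) / (1 - u^* * v); rewrite -/be -/b2 => b12.
have st0 : 1 - s^* * t != 0 by apply: mobius_denom_neq0 => //; exact: ltW.
have uv0 : 1 - u^* * v != 0 by apply: mobius_denom_neq0 => //; exact: ltW.
pose ga := b2 / be.
have beE : be * ga = b2.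
  have [be0|be0] := eqVneq be 0; last by rewrite mulrC divfK.
  move: b12; rewrite be0 modulus0 mul0r => b20; apply/esym/eqP.
  by rewrite -modulus_eq0 eq_le b20 modulus_ge0.
have ga1 : modulus ga <= 1.
  rewrite modulus_div; have [be0|be0] := eqVneq be 0.
    by rewrite be0 modulus0 invr0 mulr0.
  by rewrite ler_pdivrMr ?mul1r // modulus_gt0.
suff [P [Q [PQ Ps Pt]]] :
    exists P Q, [/\ blaschke_pair P Q, P.[s] = 0 & P.[t] = b2 * Q.[t]].
  exists (P + u *: Q), (Q + u^* *: P); split.
  - exact: blaschke_pair_mobius.
  - by rewrite !hornerE Ps mulr0 add0r addr0.
  - have vu : v - u = b2 * (1 - u^* * v) by rewrite divfK.
    rewrite !hornerE Pt; have -> : b2 * Q.[t] + u * Q.[t] = (b2 + u) * Q.[t].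
      by rewrite mulrDl.
    have -> : b2 + u = v + b2 * u^* * v.
      by rewrite -[in RHS](subrK u v) {1}vu; ring.
    ring.
move: ga1; rewrite le_eqVlt => /predU1P[ga1|ga1].
  exists (ga *: ('X - s%:P)), (1 - s^* *: 'X); split.
  - by apply: blaschke_pairZ => //; exact: blaschke_pair_factor.
  - by rewrite !hornerE subrr mulr0.
  - by rewrite !hornerE -beE [RHS]mulrAC [LHS]mulrC /be divfK.
exists (('X - s%:P) * (('X - t%:P) + ga *: (1 - t^* *: 'X))),
  ((1 - s^* *: 'X) * ((1 - t^* *: 'X) + ga^* *: ('X - t%:P))); split.
- apply: blaschke_pairM; first exact: blaschke_pair_factor.
  by apply: blaschke_pair_mobius => //; exact: blaschke_pair_factor.
- by rewrite !hornerE subrr mul0r.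
- rewrite !hornerM.
  have -> : ('X - t%:P + ga *: (1 - t^* *: 'X)).[t] = ga * (1 - t^* * t).
    by rewrite !hornerE subrr add0r.
  have -> : (1 - t^* *: 'X + ga^* *: ('X - t%:P)).[t] = 1 - t^* * t.
    by rewrite !hornerE subrr mulr0 addr0.
  have -> : ('X - s%:P).[t] = t - s by rewrite !hornerE.
  have -> : (1 - s^* *: 'X).[t] = 1 - s^* * t by rewrite !hornerE.
  by rewrite -beE /be mulrACA divfK.
Qed.

Lemma differentiable_horner P z : differentiable (horner P) z.
Proof.
elim/poly_ind: P => [|P c IH].
  rewrite (_ : horner 0 = fun=> 0); first exact: differentiable_cst.
  by apply/funext => x; rewrite horner0.
rewrite (_ : horner _ = (fun x => P.[x] * x) + (fun=> c)); last first.
  by apply/funext => x; rewrite hornerMXaddC.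
apply: differentiableD; last exact: differentiable_cst.
apply: differentiable_mulf => //; apply/derivable1_diffP; exact: derivable_id.
Qed.

Lemma continuous_horner2 (q : {poly {poly Cx R}}) :
  continuous (fun p : C2 R => q.[p.2%:P].[p.1]).
Proof.
move=> p; elim/poly_ind: q => [|q c IH].
  under [X in continuous_at _ X]eq_fun do rewrite !horner0.
  exact: cvg_cst.
under [X in continuous_at _ X]eq_fun do rewrite hornerMXaddC hornerD hornerM hornerC.
have c1 : {for p, continuous (fun p : C2 R => c.[p.1])}.
  apply: (@continuous_comp _ _ _ fst (horner c)); first exact: cvg_fst.
  exact/differentiable_continuous/differentiable_horner.
apply: (@cvgD _ _ _ _ _ (fun p : C2 R => q.[p.2%:P].[p.1] * p.2)
  (fun p : C2 R => c.[p.1])); last exact: c1.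
by apply: cvgM; [exact: IH|exact: cvg_snd].
Qed.

End Blaschke.

(** * Graphs of Blaschke products are distinguished varieties *)

Section Variety.
Context {R : realType}.
Implicit Types (q : {poly {poly Cx R}}) (s t u v z w : Cx R) (p : C2 R).

Lemma closure_disk_le1 z : closure (@disk R) z -> modulus z <= 1.
Proof.
move=> cz; apply/ler_addgt0Pr => e /real_complex_gt0 e0.
have [w [w1]] := cz _ (nbhsx_ballx z _ e0).
rewrite -ball_normE /= modulusE ltcR => zw.
have := modulus_le_dist z w; move: w1; rewrite /disk /= normr_lt1; lra.
Qed.

Lemma disk_nbhs z : @disk R z -> nbhs z (@disk R).
Proof.
rewrite /disk /= normr_lt1 => z1.
have e0 : 0 < (((1 - modulus z)%:C)%C : Cx R).
  by apply: real_complex_gt0; rewrite subr_gt0.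
apply: filterS (nbhsx_ballx z _ e0) => w.
rewrite -ball_normE /disk /= modulusE ltcR normr_lt1 modulusB => zw.
by have := modulus_le_dist w z; lra.
Qed.

Lemma torus_sub_boundary : @torus R `<=` boundary (@bidisk R).
Proof.
move=> p [[c1 n1] [c2 n2]]; split; last by move/interior_subset => -[/n1].
move=> B [[A1 A2] /= [nA1 nA2] sB].
have [x [dx Ax]] := c1 _ nA1; have [y [dy Ay]] := c2 _ nA2.
by exists (x, y); split => //; apply: sB.
Qed.

Lemma closure_fst (A : set (C2 R)) (B : set (Cx R)) p :
  (forall p, A p -> B p.1) -> closure A p -> closure B p.1.
Proof.
move=> AB cA N nN; have [] := cA (fst @^-1` N); first exact: (@cvg_fst _ _ _ _ _ N nN).
by move=> y [/AB By Ny]; exists y.1.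
Qed.

Lemma closure_snd (A : set (C2 R)) (B : set (Cx R)) p :
  (forall p, A p -> B p.2) -> closure A p -> closure B p.2.
Proof.
move=> AB cA N nN; have [] := cA (snd @^-1` N); first exact: (@cvg_snd _ _ _ _ _ N nN).
by move=> y [/AB By Ny]; exists y.2.
Qed.

Lemma closure_zero_set q (A : set (C2 R)) p :
  A `<=` zero_set q -> closure A p -> zero_set q p.
Proof.
move=> Aq cA; rewrite /zero_set /=; apply/eqP; rewrite -modulus_eq0 eq_le.
rewrite modulus_ge0 andbT; apply/ler_addgt0Pr => e /real_complex_gt0 e0.
have /cvgrPdist_lt/(_ _ e0) H := @continuous_horner2 R q p.
have [y [/Aq + yq]] := cA _ H; move: yq => /= + y0; rewrite y0 subr0.
by rewrite modulusE ltcR add0r => /ltW.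
Qed.

(** A boundary point of the bidisk in the closure of the variety is still a zero
    of [q] and has a coordinate of modulus 1, hence both by the last hypothesis. *)
Lemma distinguished_variety_zero_set q :
  (exists p p', q.[p.2%:P].[p.1] <> q.[p'.2%:P].[p'.1]) ->
  (exists p, bidisk p /\ zero_set q p) ->
  (forall p, modulus p.1 <= 1 -> modulus p.2 <= 1 -> zero_set q p ->
     modulus p.1 = 1 <-> modulus p.2 = 1) ->
  distinguished_variety (zero_set q `&` @bidisk R).
Proof.
move=> [p [p' qpp']] [x [x1 qx]] q1; exists q; split => //.
- by move=> c qc; apply: qpp'; rewrite qc !hornerC.
- by exists x.
apply/seteqP; split => y [cy By]; split => //; last exact: torus_sub_boundary.
have c1 : closure (@disk R) y.1 by apply: closure_fst cy => ? [_ []].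
have c2 : closure (@disk R) y.2 by apply: closure_snd cy => ? [_ []].
have y1 := closure_disk_le1 _ c1; have y2 := closure_disk_le1 _ c2.
have qy : zero_set q y by apply: closure_zero_set cy => ? [].
have [q12 q21] := q1 _ y1 y2 qy.
have not_in : ~ bidisk y.
  move=> [d1 d2]; case: By => _; apply.
  by exists (@disk R, @disk R) => //; split; exact: disk_nbhs.
have eq1 z : modulus z <= 1 -> ~ disk z -> modulus z = 1.
  move=> z1 nz; apply/eqP; rewrite eq_le z1 /= leNgt; apply/negP => z2.
  by apply: nz; rewrite /disk /= normr_lt1.
have [d1|n1] := pselect (disk y.1).
  have m2 : modulus y.2 = 1 by apply: eq1 => // d2; exact: not_in.
  by move: d1; rewrite /disk /= normr_lt1 (q21 m2) ltxx.
have n2 : ~ disk y.2.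
  by rewrite /disk /= normr_lt1 (q12 (eq1 _ y1 n1)) ltxx.
exact: (conj (conj c1 n1) (conj c2 n2)).
Qed.

Lemma blaschke_graph s t u v :
  modulus s < 1 -> modulus t < 1 -> modulus u < 1 -> modulus v < 1 ->
  modulus (v - u) / modulus (1 - u^* * v) <=
    modulus (t - s) / modulus (1 - s^* * t) ->
  exists P Q, let phi z := P.[z] / Q.[z] in
    [/\ blaschke_pair P Q, phi s = u, phi t = v,
        (forall z, `|z| < 1 -> `|phi z| < 1) &
        (forall z, `|z| < 1 -> differentiable phi z)].
Proof.
move=> s1 t1 u1 v1 le.
have [P [Q [PQ Ps Pt]]] :=
  blaschke_interpolation _ _ _ _ s1 t1 u1 v1 le.
exists P, Q => phi.
have Q0 z : modulus z < 1 -> 0 < modulus Q.[z].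
  by move=> /(PQ z).1; apply: le_lt_trans; exact: modulus_ge0.
split => //.
- by rewrite /phi Ps mulfK // -modulus_gt0 Q0.
- by rewrite /phi Pt mulfK // -modulus_gt0 Q0.
- move=> z; rewrite !normr_lt1 modulus_div => z1.
  by rewrite ltr_pdivrMr ?Q0 // mul1r; exact: (PQ z).1.
- move=> z; rewrite normr_lt1 => z1.
  by apply: differentiable_divf;
    [rewrite -modulus_gt0 Q0|exact: differentiable_horner..].
Qed.

Lemma blaschke_pair_zero (P Q : {poly Cx R}) z w :
  blaschke_pair P Q -> modulus z <= 1 -> Q.[z] * w - P.[z] = 0 ->
  modulus z = 1 <-> modulus w = 1.
Proof.
move=> PQ z1 /eqP; rewrite subr_eq0 => /eqP/(congr1 modulus); rewrite modulusM => E.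
split => [z11|w1].
  have [PQz] := (PQ z).2 z11; rewrite -modulus_eq0 => Q0.
  by apply: (mulfI Q0); rewrite mulr1 E.
move: z1; rewrite le_eqVlt => /predU1P[//|/(PQ z).1].
by rewrite -E w1 mulr1 ltxx.
Qed.

Lemma blaschke_pair_denom0 (P Q : {poly Cx R}) : blaschke_pair P Q -> Q.[0] != 0.
Proof.
move=> PQ; rewrite -modulus_gt0; apply: le_lt_trans (modulus_ge0 P.[0]) _.
by apply: (PQ 0).1; rewrite modulus0.
Qed.

Lemma distinguished_variety_graph (P Q : {poly Cx R}) :
  blaschke_pair P Q -> exists W : set (C2 R), distinguished_variety W /\
    forall p, bidisk p -> Q.[p.1] * p.2 - P.[p.1] = 0 -> W p.
Proof.
move=> PQ; pose q : {poly {poly Cx R}} := Q%:P * 'X - P%:P.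
have Q0 := blaschke_pair_denom0 _ _ PQ.
have qE z w : q.[w%:P].[z] = Q.[z] * w - P.[z] by rewrite /q !hornerE.
exists (zero_set q `&` @bidisk R); split; last first.
  by move=> p pd E; split => //; rewrite /zero_set /= qE.
apply: distinguished_variety_zero_set.
- exists (0, 0), (0, 1); rewrite /= !qE mulr0 mulr1 => /addIr/esym/eqP.
  exact/negP.
- exists (0, P.[0] / Q.[0]); split; last by rewrite /zero_set /= qE mulrC divfK // subrr.
  split; rewrite /disk /= normr_lt1 ?modulus0 // modulus_div.
  by rewrite ltr_pdivrMr ?modulus_gt0 // mul1r; apply: (PQ 0).1; rewrite modulus0.
- by move=> p p1 p2; rewrite /zero_set /= qE => /(blaschke_pair_zero _ _ _ _ PQ p1).
Qed.

Lemma distinguished_variety_cograph (P Q : {poly Cx R}) :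
  blaschke_pair P Q -> exists W : set (C2 R), distinguished_variety W /\
    forall p, bidisk p -> Q.[p.2] * p.1 - P.[p.2] = 0 -> W p.
Proof.
move=> PQ; pose q : {poly {poly Cx R}} :=
  map_poly polyC Q * ('X)%:P - map_poly polyC P.
have Q0 := blaschke_pair_denom0 _ _ PQ.
have qE z w : q.[w%:P].[z] = Q.[w] * z - P.[w].
  by rewrite /q !(hornerD, hornerN, hornerM, hornerC) !horner_map /= !hornerE.
exists (zero_set q `&` @bidisk R); split; last first.
  by move=> p pd E; split => //; rewrite /zero_set /= qE.
apply: distinguished_variety_zero_set.
- exists (0, 0), (1, 0); rewrite /= !qE mulr0 mulr1 => /addIr/esym/eqP.
  exact/negP.
- exists (P.[0] / Q.[0], 0); split; last by rewrite /zero_set /= qE mulrC divfK // subrr.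
  split; rewrite /disk /= normr_lt1 ?modulus0 // modulus_div.
  by rewrite ltr_pdivrMr ?modulus_gt0 // mul1r; apply: (PQ 0).1; rewrite modulus0.
- move=> p p1 p2; rewrite /zero_set /= qE => /(blaschke_pair_zero _ _ _ _ PQ p2).
  by move=> ->.
Qed.

(** An analytic disk inside a distinguished variety, through both points and
    with parameters at the pseudo-hyperbolic distance on the right-hand side of
    the Schwarz-Pick inequality. *)
Lemma distinguished_disk (a b : C2 R) : bidisk a -> bidisk b ->
  exists W gam s t,
    [/\ distinguished_variety W,
        (forall z : Cx R, `|z| < 1 -> differentiable (gam : Cx R -> C2 R) z /\ W (gam z)),
        `|s| < 1 /\ `|t| < 1, gam s = a /\ gam t = b &
        pseudo_hyperbolic s t <=
          Num.max (pseudo_hyperbolic a.1 b.1) (pseudo_hyperbolic a.2 b.2)].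
Proof.
case: a => a1 a2; case: b => b1 b2 [/= A1 A2] [/= B1 B2].
move: (A1) (A2) (B1) (B2); rewrite /disk /= !normr_lt1 => A1' A2' B1' B2'.
have did z : differentiable (id : Cx R -> Cx R) z.
  by apply/derivable1_diffP; exact: derivable_id.
rewrite !pseudo_hyperbolicE /Order.max ltcR.
rewrite [modulus (a1 - b1)]modulusB [modulus (a2 - b2)]modulusB.
case: ltP => [/ltW|] le.
- have [P [Q [PQ fs ft f1 df]]] := blaschke_graph _ _ _ _ A2' B2' A1' B1' le.
  have [W [dW WP]] := distinguished_variety_cograph _ _ PQ.
  exists W, (fun z => (P.[z] / Q.[z], z)), a2, b2; split => //.
  + move=> z z1; split; first by apply: differentiable_pair => //; exact: df.
    apply: WP; first by split => //; exact: f1.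
    rewrite /= mulrC divfK ?subrr // -modulus_gt0.
    apply: le_lt_trans (modulus_ge0 P.[z]) _.
    by apply: (PQ z).1; rewrite -normr_lt1.
  + by rewrite fs ft.
  + by rewrite pseudo_hyperbolicE modulusB.
- have [P [Q [PQ fs ft f1 df]]] := blaschke_graph _ _ _ _ A1' B1' A2' B2' le.
  have [W [dW WP]] := distinguished_variety_graph _ _ PQ.
  exists W, (fun z => (z, P.[z] / Q.[z])), a1, b1; split => //.
  + move=> z z1; split; first by apply: differentiable_pair => //; exact: df.
    apply: WP; first by split => //; exact: f1.
    rewrite /= mulrC divfK ?subrr // -modulus_gt0.
    apply: le_lt_trans (modulus_ge0 P.[z]) _.
    by apply: (PQ z).1; rewrite -normr_lt1.
  + by rewrite fs ft.
  + by rewrite pseudo_hyperbolicE modulusB.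
Qed.

End Variety.

(** * The Schwarz-Pick inequality from a distinguished variety *)

Lemma dilate_cvg {R : realType} (r : nat -> R) (p : C2 R) :
  r @ \oo --> (1 : R) -> dilate (r n) p @[n --> \oo] --> p.
Proof.
move=> r1.
have rC : (((r n)%:C)%C : Cx R) @[n --> \oo] --> (1 : Cx R).
  apply/cvgrPdist_lt => e e0.
  have e0' : 0 < modulus e by rewrite modulus_gt0 gt_eqF.
  move/cvgrPdist_lt : r1 => /(_ _ e0'); apply: filterS => n rn.
  rewrite -[e]gtr0_norm // [X in _ < X]modulusE modulusE ltcR.
  have -> : 1 - ((r n)%:C)%C = ((1 - r n)%:C)%C :> Cx R by rewrite rmorphB rmorph1.
  by rewrite modulus_real.
have rM (z : Cx R) : (((r n)%:C)%C : Cx R) * z @[n --> \oo] --> z.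
  rewrite -[X in _ --> X]mul1r.
  apply: cvgM; first exact: rC.
  exact: cvg_cst.
by case: p => z w; exact: (cvg_pair (rM z) (rM w)).
Qed.

Lemma modulus_le1_of_dilates {R : realType} (f : C2 R -> Cx R) (r : nat -> R)
    (p : C2 R) :
  {for p, continuous f} -> r @ \oo --> (1 : R) ->
  (forall n, `|f (dilate (r n) p)| <= 1) -> `|f p| <= 1.
Proof.
move=> cf r1 fr; rewrite normr_le1; apply/ler_addgt0Pr => e e0.
have := cvg_comp _ _ (dilate_cvg _ p r1) cf.
move/cvgrPdist_lt => /(_ _ (real_complex_gt0 _ e0))[N _ /(_ N (leqnn N))] /=.
rewrite modulusE ltcR => H.
have := modulus_le_dist (f p) (f (dilate (r N) p)).
by have := fr N; rewrite normr_le1; lra.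
Qed.

Theorem theorem4p5 (R : realType) :
  (forall a b : C2 R, @bidisk R a -> @bidisk R b ->
     exists W : set (C2 R), distinguished_variety W /\
       forall f : C2 R -> Cx R,
         holomorphic_on (@bidisk R) f ->
         {within @closed_bidisk R, continuous f} ->
         (forall p : C2 R, W p -> `|f p| <= 1) ->
         schwarz_pick f a b) /\
  (forall a b : C2 R, @bidisk R a -> @bidisk R b ->
     exists W : set (C2 R), distinguished_variety W /\
       forall f : C2 R -> Cx R,
         holomorphic_on (@bidisk R) f ->
         (exists r : nat -> R,
            [/\ forall n : nat, 0 < r n < 1,
                r @ \oo --> (1 : R) &
                forall (n : nat) (p : C2 R), W p -> `|f (dilate (r n) p)| <= 1]) ->
         schwarz_pick f a b).
Proof.
have main (a b : C2 R) : bidisk a -> bidisk b ->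
    exists W : set (C2 R), distinguished_variety W /\
      forall f : C2 R -> Cx R, holomorphic_on (@bidisk R) f ->
        (forall p, W p -> `|f p| <= 1) -> schwarz_pick f a b.
  move=> A B; have [W [gam [s [t [dW gamP [s1 t1] [gs gt] le]]]]] :=
    distinguished_disk _ _ A B.
  exists W; split=> // f df fW.
  have WD p : W p -> bidisk p by case: dW => q [_ -> _ _] [].
  apply: (schwarz_pick_along_disk f gam _ _ s t) => // z z1;
    have [dgam Wz] := gamP z z1.
  - exact: (differentiable_comp dgam (df _ (WD _ Wz))).
  - exact: fW.
split=> a b A B; have [W [dW WP]] := main a b A B; exists W; split=> // f df.
- by move=> _; exact: WP.
- move=> [r [_ r1 fr]]; apply: WP => // p Wp.
  apply: modulus_le1_of_dilates r1 _ => [|n]; last exact: fr.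
  apply: differentiable_continuous; apply: df.
  by case: dW Wp => q [_ -> _ _] [].
Qed.
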